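(* Let $\phi=x^2+t\in\mathbb{Z}[t][x]$. Then for every odd prime $p$, the arboreal representation $\rho_{\phi_p}$ of the reduction $\phi_p=x^2+t\in\mathbb{F}_p[t][x]$ is geometrically surjective, i.e. $G_\infty^{\mathrm{geo}}(\phi_p)=\mathrm{Aut}(\mathcal{T}_\infty(\phi_p))$.
   Context: For a field $k$ of characteristic $\neq 2$ and a monic quadratic $\phi\in k[t][x]$ with all iterates separable, $\mathcal{T}_\infty(\phi)$ is the infinite rooted binary tree whose nodes at level $n$ are the roots of the $n$-th iterate $\phi^{(n)}$ in $k(t)^{\mathrm{sep}}$ (root $0$ at level $0$), with $\alpha$ at level $n+1$ joined to $\beta$ at level $n$ iff $\phi(\alpha)=\beta$. The absolute Galois group of $k(t)$ acts on this tree via the arboreal representation $\rho_\phi$; the geometric part $G_\infty^{\mathrm{geo}}(\phi)$ is the image of $\mathrm{Gal}(k(t)^{\mathrm{sep}}/k^{\mathrm{sep}}(t))$, i.e. $\varprojlim_n\mathrm{Gal}(\phi^{(n)}/k^{\mathrm{sep}}(t))$; $\rho_\phi$ is geometrically surjective if this equals the full automorphism group $\mathrm{Aut}(\mathcal{T}_\infty(\phi))$. *)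

(* Defs.v *)
From mathcomp Require Import all_boot all_order all_algebra all_field.

Set Implicit Arguments.
Unset Strict Implicit.
Unset Printing Implicit Defensive.

Import GRing.Theory.
Local Open Scope ring_scope.

(** * Separable closures *)

(* [separable_poly q] forces [q != 0]; the minimal polynomial of [x] divides
   any such [q], so this is separability (hence algebraicity) of [x]. *)
Definition separable_over (F L : fieldType) (f : {rmorphism F -> L}) (x : L) :
    Prop :=
  exists2 q : {poly F}, separable_poly q & root (map_poly f q) x.

Definition separably_closed (L : fieldType) : Prop :=
  forall q : {poly L}, separable_poly q -> (1 < size q)%N ->
  exists x : L, root q x.

Definition is_separable_closure (F L : fieldType) (f : {rmorphism F -> L}) :
    Prop :=
  (forall x : L, separable_over f x) /\ separably_closed L.

(** * Iterates *)

(* An element of k[t][x] is a [{poly {poly k}}]: the outer variable is x and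
   the inner one is t. The 0-th iterate is x. *)
Definition iterate (A : comNzRingType) (phi : {poly A}) (n : nat) : {poly A} :=
  iter n (fun q => phi \Po q) 'X.

Definition iterates_separable (k : fieldType) (phi : {poly {poly k}}) : Prop :=
  forall n, separable_poly (map_poly (@tofrac {poly k}) (iterate phi n)).

(* The standing assumptions under which the preimage tree is binary. *)
Definition arboreal (k : fieldType) (phi : {poly {poly k}}) : Prop :=
  [/\ 2%:R != 0 :> k, phi \is monic, size phi = 3%N & iterates_separable phi].

(** * The arboreal representation of phi in k[t][x]

    [L] plays the role of k(t)^sep, through [iota : k(t) -> L]. *)

Section Arboreal.

Variables (k L : fieldType) (iota : {rmorphism {fraction {poly k}} -> L}).

Definition poly_incl : {rmorphism {poly k} -> L} := iota \o @tofrac {poly k}.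

Definition const_incl : {rmorphism k -> L} := poly_incl \o polyC.

Definition in_ksep (x : L) : Prop := separable_over const_incl x.

Definition in_ksep_t (x : L) : Prop :=
  exists q r : {poly L},
    [/\ forall i, in_ksep q`_i, forall i, in_ksep r`_i,
        r.[poly_incl 'X] != 0 & x = q.[poly_incl 'X] / r.[poly_incl 'X]].

Record absolute_galois := AbsoluteGalois {
  gal_fun :> {rmorphism L -> L};
  gal_bij : bijective gal_fun;
  gal_fix : forall a, gal_fun (iota a) = iota a
}.

Definition in_geometric_galois (g : absolute_galois) : Prop :=
  forall x, in_ksep_t x -> g x = x.

Variable phi : {poly {poly k}}.

(* A node is tagged with its level, so that distinct levels are disjoint. *)
Definition node : Type :=
  {u : nat * L | root (map_poly poly_incl (iterate phi u.1)) u.2}.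

Definition level (u : node) : nat := (val u).1.
Definition node_val (u : node) : L := (val u).2.

Lemma tree_root_subproof : root (map_poly poly_incl (iterate phi 0)) 0.
Proof. by rewrite /iterate /= map_polyX rootX. Qed.

Definition tree_root : node := exist _ (0%N, 0) tree_root_subproof.

Definition child (v u : node) : bool :=
  (level v == (level u).+1)
  && ((map_poly poly_incl phi).[node_val v] == node_val u).

Definition adjacent (u v : node) : bool := child u v || child v u.

Definition is_tree_automorphism (sigma : node -> node) : Prop :=
  [/\ bijective sigma, sigma tree_root = tree_root
    & forall u v, adjacent (sigma u) (sigma v) = adjacent u v].

Lemma gal_node_subproof (g : absolute_galois) (u : node) :
  root (map_poly poly_incl (iterate phi (level u))) (g (node_val u)).
Proof.
have fixP : map_poly g (map_poly poly_incl (iterate phi (level u)))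
            = map_poly poly_incl (iterate phi (level u)).
  by rewrite -map_poly_comp; apply: eq_map_poly => a; apply: gal_fix.
by rewrite -fixP fmorph_root; apply: (valP u).
Qed.

Definition arboreal_rep (g : absolute_galois) (u : node) : node :=
  exist _ (level u, g (node_val u)) (gal_node_subproof g u).

Definition in_geometric_image (sigma : node -> node) : Prop :=
  exists2 g : absolute_galois, in_geometric_galois g
    & arboreal_rep g =1 sigma.

Definition geometrically_surjective : Prop :=
  forall sigma : node -> node,
    in_geometric_image sigma <-> is_tree_automorphism sigma.

End Arboreal.

(** * The polynomial x^2 + t and its reductions *)

Definition phi_Z : {poly {poly int}} := 'X^2 + 'X%:P.

Definition reduction (p : nat) (f : {poly {poly int}}) :
    {poly {poly 'F_p}} :=
  map_poly (map_poly (intr : int -> 'F_p)) f.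

Lemma reduction_phi (p : nat) : reduction p phi_Z = 'X^2 + 'X%:P.
Proof.
by rewrite /reduction /phi_Z rmorphD /= map_polyXn map_polyC /= map_polyX.
Qed.

Lemma phi_iterateS (A : comNzRingType) (t : A) n :
  iterate ('X^2 + t%:P) n.+1 = iterate ('X^2 + t%:P) n ^+ 2 + t%:P.
Proof. by rewrite /iterate /= comp_polyD comp_polyC comp_Xn_poly. Qed.

Lemma phi_iterateD (A : comNzRingType) (phi : {poly A}) m n :
  iterate phi (m + n) = iterate phi m \Po iterate phi n.
Proof.
elim: m => [|m IHm]; first by rewrite /iterate /= comp_polyX.
by rewrite addSn /iterate /= -!/(iterate _ _) IHm comp_polyA.
Qed.

Lemma phi_iterate0 (k : fieldType) n :
  (iterate ('X^2 + 'X%:P : {poly {poly k}}) n.+1).[0] != 0.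
Proof.
set f := _ + _.
suff [a aE]: exists a : {poly k}, (iterate f n.+1).[0] = 'X + a * 'X^2.
  apply/eqP => /(congr1 (fun q : {poly k} => q`_1)).
  by rewrite aE coefD coefX coefMXn coef0 /= addr0 => /eqP; rewrite oner_eq0.
elim: n => [|n [a aE]]; rewrite phi_iterateS !hornerE.
  by exists 0; rewrite /iterate /= !hornerE /= expr0n /= add0r.
exists ((1 + a * 'X) ^+ 2).
by rewrite aE addrC -exprMn mulrDl mul1r expr2 mulrA.
Qed.

Lemma reduction_phi_arboreal (p : nat) :
  prime p -> odd p -> arboreal (reduction p phi_Z).
Proof.
move=> p_pr p_odd; rewrite reduction_phi.
have two_neq0 : 2%:R != 0 :> 'F_p.
  rewrite -(dvdn_pcharf (pchar_Fp p_pr)).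
  by rewrite dvdn_prime2 //; apply: contraL p_odd => /eqP->.
have szX2 : (size ('X%:P : {poly {poly 'F_p}})
             < size ('X^2 : {poly {poly 'F_p}}))%N.
  by rewrite size_polyXn (leq_ltn_trans (size_polyC_leq1 _)).
split=> //; first by rewrite monicE lead_coefDl // lead_coefXn.
  by rewrite size_polyDl // size_polyXn.
move=> n; set f := _ + _.
rewrite unlock.
pose F m := map_poly (@tofrac {poly 'F_p}) (iterate f m).
have FS m : F m.+1 = F m ^+ 2 + (tofrac 'X)%:P.
  by rewrite /F phi_iterateS rmorphD rmorphXn /= map_polyC.
have cop i m : coprimep (F (m.+1 + i)%N) (F i).
  have [r rE] : exists r,
      F (m.+1 + i)%N = r * F i + (tofrac (iterate f m.+1).[0])%:P.
    rewrite /F phi_iterateD.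
    have /factor_theorem[q qE]:
        root (iterate f m.+1 - (iterate f m.+1).[0]%:P) 0.
      by rewrite /root !hornerE subrr.
    move: (_.[0]) qE => c; rewrite polyC0 subr0.
    move=> /(canRL (subrK _)) ->.
    exists (map_poly (@tofrac _) (q \Po iterate f i)).
    rewrite comp_polyD comp_polyM comp_polyX comp_polyC.
    by rewrite rmorphD rmorphM /= map_polyC.
  rewrite coprimep_sym rE coprimep_addl_mul coprimep_sym.
  rewrite -alg_polyC coprimepZl ?coprime1p //.
  by rewrite tofrac_eq0 phi_iterate0.
suff H m i : (m <= i)%N -> coprimep (F i) (F m)^`() by apply: H.
elim: m => [|m IHm] lt_mi.
  by rewrite /F /iterate /= map_polyX derivX coprimep1.
rewrite FS derivD derivC addr0 deriv_exp /= expr1 -mulr_natr.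
have copim: coprimep (F i) (F m).
  have ->: i = ((i - m.+1).+1 + m)%N by rewrite addSnnS subnK.
  exact: cop.
rewrite !coprimepMr IHm 1?ltnW // copim /= -polyC_natr coprimep_sym -alg_polyC.
rewrite coprimepZl ?coprime1p //.
by rewrite -(rmorph_nat (@tofrac _)) tofrac_eq0 -polyC_natr polyC_eq0.
Qed.

(* Main.v *)
From HB Require Import structures.
Require Import Defs.
From mathcomp Require Import all_boot all_order all_algebra all_field.
From mathcomp Require Import generic_quotient zify ring boolp classical_sets.

(* Let c_n be the n-th iterate of 0 under x^2 + t.  By the usual descent along
   the tree, whose group is a pro-2 group, the geometric group is full as soon
   as no product of distinct c_i is a square over the algebraic closure of the
   constants: if flips at level n were missing, an orthogonality relation
   invariant under the group would make the product of the square roots of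
   b - t, over all nodes b of level n, fixed by the stabiliser of level n; this
   product is a square root of c_{n+1} up to sign, and it descends, after
   multiplication by square roots of earlier c_i, to the base field.

   In characteristic p the c_n need not be squarefree, so the independence
   modulo squares is proved by a degree argument.  Since c_{a+b} is congruent to
   c_a modulo c_b^2, a square product of c_i's with largest index n forces
   c_n = D y^2 with deg D < 2^(n/2).  Put t = -X^2 and x = c_{n-2}: then
   (x^2 - X^2 + X) (x^2 - X^2 - X) = D y^2 gives two simultaneous conics
   x^2 - X^2 + X = q h^2 and x^2 - X^2 - X = q1 h1^2 with q, q1 of small degree,
   and the relations obtained by differentiating them are incompatible with the
   degrees of the coprime polynomials h and h1.

   Automorphisms of the separable closure are produced by Zorn's lemma from the
   graphs of partial embeddings; the whole tree is handled at once by the graph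
   of those pairs on which all realisations up to some level agree. *)

Set Implicit Arguments.
Unset Strict Implicit.
Unset Printing Implicit Defensive.

Import GRing.Theory.
Local Open Scope ring_scope.

(** * Critical orbit and squares *)

Definition crit (A : nzRingType) (n : nat) : {poly A} :=
  iter n (fun q => q ^+ 2 + 'X) 0.
Arguments crit A n : simpl never.

Section CriticalOrbit.

Variable F : fieldType.

Local Notation c := (crit F).

Lemma critS n : c n.+1 = c n ^+ 2 + 'X.
Proof. by []. Qed.

Lemma size_crit n : size (c n.+1) = (2 ^ n).+1.
Proof.
elim: n => [|n IHn]; first by rewrite critS expr0n /= add0r size_polyX.
have szE : size (c n.+1 ^+ 2) = (2 ^ n.+1).+1.
  rewrite expr2 size_mul -?size_poly_eq0 IHn // addnS expnS mul2n -addnn; lia.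
rewrite critS size_polyDl szE // size_polyX expnS.
by have := expn_gt0 2 n; lia.
Qed.

Lemma crit_neq0 n : c n.+1 != 0.
Proof. by rewrite -size_poly_eq0 size_crit. Qed.

Lemma crit_at0 n : (c n).[0] = 0.
Proof.
elim: n => [|n IHn]; first by rewrite horner0.
by rewrite critS hornerD horner_exp hornerX IHn expr0n addr0.
Qed.

(** As ['X] divides [c n], the polynomial [c n.+1] reduces to ['X] modulo ['X ^+ 2]. *)
Lemma crit_sqr_ndvd n : ~~ ('X ^+ 2 %| c n.+1).
Proof.
rewrite critS; apply/negP => dv.
have /factor_theorem[w wE] : root (c n) 0 by rewrite /root crit_at0.
have : 'X ^+ 2 %| ('X : {poly F}).
  rewrite -(dvdp_addr _ (_ : 'X ^+ 2 %| c n ^+ 2)) // wE subr0 exprMn.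
  exact: dvdp_mull.
by move/dvdp_leq; rewrite polyX_eq0 size_polyXn size_polyX => /(_ isT).
Qed.

(** The orbit restarts from [c b], which is 0 modulo [c b]; the first squaring improves this
    congruence to the modulus [c b ^+ 2]. *)
Lemma crit_addS a b : c b ^+ 2 %| c (a.+1 + b) - c a.+1.
Proof.
elim: a => [|a IHa]; first by rewrite add1n !critS expr0n add0r /= addrK dvdpp.
rewrite addSn !(critS _.+1) (critS (_ + _)) opprD addrACA subrr addr0 subr_sqr.
exact: dvdp_mulr.
Qed.

Lemma crit_add a b : c b %| c (a + b) - c a.
Proof.
case: a => [|a]; first by rewrite add0n subr0.
by apply: dvdp_trans (crit_addS a b); rewrite dvdp_exp.
Qed.

(** Euclid's algorithm on the indices, each subtraction being an instance of [crit_add]. *)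
Lemma crit_dvd_gcd (d : {poly F}) a b :
  d %| c a -> d %| c b -> d %| c (gcdn a b).
Proof.
have [m le_m] := ubnP (a + b).
elim: m a b le_m => // m IHm a b le_m.
wlog le_ab : a b le_m / (a <= b)%N => [hw | da db].
  case: (leqP a b) => [/hw|/ltnW le_ba da db]; first exact.
  by rewrite gcdnC; apply: hw => //; rewrite addnC.
case: a => [|a] in le_m le_ab da *; first by rewrite gcd0n.
rewrite -(subnKC le_ab) gcdnDl; apply: IHm => //; first lia.
have : d %| c (b - a.+1 + a.+1) - c (b - a.+1).
  exact: dvdp_trans da (crit_add _ _).
by rewrite subnK // dvdp_subr.
Qed.

(** By [crit_addS], [c n] is [c m] times a polynomial congruent to 1 modulo [c m], so a prime factor
    of [c m] keeps its multiplicity in [c n]. *)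
Lemma crit_dvd_coprime m n : (0 < m)%N -> (m %| n)%N -> (0 < n)%N ->
  exists2 u, c n = c m * u & coprimep u (c m).
Proof.
move=> m_gt0 /dvdnP[k ->]; rewrite muln_gt0 => /andP[k_gt0 _].
suff [u uE] : exists u, c (k * m) = c m * (1 + c m * u).
  by exists (1 + c m * u); rewrite // coprimep_sym addrC mulrC coprimep_addl_mul coprimep1.
case: k k_gt0 => // k _; elim: k => [|k [u uE]].
  by exists 0; rewrite mul1n mulr0 addr0 mulr1.
have /dvdpP[w wE] := crit_addS m.-1 (k.+1 * m).
rewrite mulSn; exists ((1 + c m * u) ^+ 2 * w).
move/eqP: wE; rewrite prednK // subr_eq => /eqP->; rewrite uE; ring.
Qed.

(** The indices in [s] are treated one by one, moving [gcdp B (c m)] from [B] to [R]. What is left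
    of [B] divides the cofactor of [c m] in [c n], which is coprime to [c m]. *)
Lemma crit_split n (s : seq nat) :
    (0 < n)%N -> {in s, forall m, (0 < m)%N && (m %| n)%N} ->
  exists B R, [/\ c n = B * R, R %| \prod_(m <- s) c m
    & {in s, forall m, coprimep B (c m)}].
Proof.
move=> n_gt0; elim: s => [|m s IHs] sP.
  by exists (c n), 1; rewrite mulr1 big_nil dvdpp.
have {IHs} [i i_s|B [R [nE Rs cops]]] := IHs.
  by apply: sP; rewrite inE i_s orbT.
have /andP[m_gt0 m_n] := sP m (mem_head _ _).
have [u uE copu] := crit_dvd_coprime m_gt0 m_n n_gt0.
have cm0 : c m != 0 by rewrite -(prednK m_gt0) crit_neq0.
set g := gcdp B (c m).
have g0 : g != 0 by rewrite gcdp_eq0 negb_and cm0 orbT.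
have BE : B = B %/ g * g by rewrite divpK ?dvdp_gcdl.
have mE : c m = c m %/ g * g by rewrite divpK ?dvdp_gcdr.
exists (B %/ g), (g * R); split.
- by rewrite mulrA -BE.
- by rewrite big_cons dvdp_mul ?dvdp_gcdr.
move=> i; rewrite inE => /orP[/eqP->|/cops]; last first.
  by apply: coprimep_dvdr; rewrite {2}BE dvdp_mulr.
have : B %/ g %| u.
  have : B %| c m * u by rewrite -uE nE dvdp_mulr.
  rewrite {1}BE {1}mE mulrAC dvdp_mul2r // Gauss_dvdpr //.
  by rewrite coprimep_div_gcd // cm0 orbT.
by move/coprimep_dvdr/(_ copu).
Qed.

(** [B] is the primitive part of [c n]. Proper divisors of [n] are at most [n./2], so [R] divides
    the product of the first [n./2] terms, which has degree [2 ^ n./2 - 1]. A factor that [B] shares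
    with any other [c m] already divides [c (gcdn m n)]. *)
Lemma crit_primitive_part n : (0 < n)%N ->
  exists B R, [/\ c n = B * R, coprimep B R, (size R <= 2 ^ n./2)%N
    & forall m, (0 < m < n)%N -> coprimep B (c m)].
Proof.
move=> n_gt0; pose s := [seq m <- iota 1 n./2 | m %| n]%N.
have [m|B [R [nE Rs cops]]] := @crit_split n s n_gt0.
  by rewrite mem_filter mem_iota => /and3P[-> ->].
have prod0 k : (size (\prod_(m <- iota 1 k) c m)%R <= 2 ^ k)%N /\
    \prod_(m <- iota 1 k) c m != 0.
  elim: k => [|k [IH1 IH2]]; first by rewrite big_nil size_poly1 oner_neq0.
  rewrite -[k.+1]addn1 iotaD big_cat /= big_seq1 add1n mulf_neq0 ?crit_neq0 //.
  rewrite size_mul ?crit_neq0 // size_crit expnD expn1 addnS muln2 -addnn.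
  by rewrite leq_add2r.
have Rbig : R %| \prod_(m <- iota 1 n./2) c m.
  apply: dvdp_trans Rs _; rewrite /s big_filter; elim: (iota _ _) => [|i r IHr].
    by rewrite !big_nil dvdpp.
  by rewrite !big_cons; case: ifP => _; [apply: dvdp_mul | apply: dvdp_mull].
exists B, R; split=> //.
- apply: coprimep_dvdl Rs _; elim: s cops {nE Rbig} => [|m s IHs] cops.
    by rewrite big_nil coprimep1.
  rewrite big_cons coprimepMr cops ?mem_head // IHs // => i i_s.
  by apply: cops; rewrite inE i_s orbT.
- by apply: leq_trans (dvdp_leq (prod0 _).2 Rbig) (prod0 _).1.
move=> m /andP[m_gt0 m_lt]; apply/coprimepP => d dB dm.
have /cops copB : gcdn m n \in s.
  rewrite mem_filter dvdn_gcdr mem_iota gcdn_gt0 m_gt0 /= add1n ltnS.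
  have /dvdnP[[|[|k]] kE] := dvdn_gcdr m n; [lia | | nia].
  by have := dvdn_leq m_gt0 (dvdn_gcdl m n); lia.
move/coprimepP: copB; apply=> //.
by apply: crit_dvd_gcd => //; rewrite nE dvdp_mulr.
Qed.

End CriticalOrbit.

(** * Coprime factors of a square *)

Section Squares.

Variable F : fieldType.

(** Once [q] and [w] are made coprime, [w ^+ 2] divides [q ^+ 2] and is therefore constant; then [B]
    and the square of its gcd with [q] divide each other. *)
Lemma coprimep_sqr (B M q w : {poly F}) : coprimep B M -> w != 0 ->
  q ^+ 2 = B * M * w ^+ 2 -> exists a g, a != 0 /\ B = a *: g ^+ 2.
Proof.
move=> copBM w0 qE; set d := gcdp q w.
have d0 : d != 0 by rewrite gcdp_eq0 negb_and w0 orbT.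
have qd : q = q %/ d * d by rewrite divpK ?dvdp_gcdl.
have wd : w = w %/ d * d by rewrite divpK ?dvdp_gcdr.
have {qE} : (q %/ d) ^+ 2 = B * M * (w %/ d) ^+ 2.
  apply: (mulIf (expf_neq0 2 d0)).
  by rewrite -exprMn -qd qE {1}wd exprMn mulrA.
have : coprimep (q %/ d) (w %/ d) by rewrite coprimep_div_gcd // w0 orbT.
move: (q %/ d) (w %/ d) => {qd wd d0 w0} q' w' cop qE.
have /dvdpP[z zE] : B %| q' ^+ 2 by rewrite qE -mulrA dvdp_mulr.
have copq : coprimep (q' ^+ 2) (w' ^+ 2).
  by rewrite coprimep_pexpl ?coprimep_pexpr.
have [k k0 kE] : exists2 k : F, k != 0 & w' ^+ 2 = k%:P.
  apply/size_poly1P; rewrite size_poly_eq1.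
  move/coprimepP: copq; apply; rewrite ?dvdpp // qE dvdp_mull //.
set g := gcdp q' B.
have Bg : B %| g ^+ 2.
  have Bgq : B %| g * q'.
    rewrite mulrC (eqp_dvdr _ (mulp_gcdr _ _ _)) dvdp_gcd -expr2.
    by rewrite {1}zE dvdp_mull ?dvdpp // dvdp_mull.
  by rewrite expr2 (eqp_dvdr _ (mulp_gcdr _ _ _)) dvdp_gcd Bgq dvdp_mull.
have gB : g ^+ 2 %| B.
  have : g ^+ 2 %| B * M.
    rewrite -(dvdpZr _ _ k0) -mul_polyC mulrC -kE -qE.
    by rewrite dvdp_exp2r ?dvdp_gcdl.
  rewrite Gauss_dvdpl // coprimep_expl //.
  by apply: coprimep_dvdr copBM; rewrite dvdp_gcdr.
have /eqpP[[a b] /= /andP[a0 b0] abE] : B %= g ^+ 2 by rewrite /eqp Bg.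
exists (b / a), g; split; first by rewrite mulf_neq0 ?invr_eq0.
by rewrite mulrC -scalerA -abE scalerA mulVf // scale1r.
Qed.
End Squares.

(** * Independence of the critical orbit modulo squares *)

Section Core.

Variable F : fieldType.
Hypothesis two_neq0 : 2%:R != 0 :> F.

Local Notation c := (crit F).

Lemma dvdp_mul_gcdp (p a b : {poly F}) : p %| a * b -> p %| gcdp p a * gcdp p b.
Proof.
move=> p_ab; rewrite (eqp_dvdr _ (mulp_gcdl _ _ _)) dvdp_gcd dvdp_mulr //=.
by rewrite (eqp_dvdr _ (mulp_gcdr _ _ _)) dvdp_gcd p_ab dvdp_mull.
Qed.

Lemma coprimep_X (p : {poly F}) : p.[0] != 0 -> coprimep p 'X.
Proof. by move=> p0; rewrite -['X]subr0 -polyC0 coprimep_XsubC. Qed.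

Lemma crit_cofactor_at0 n (D y : {poly F}) : c n.+1 = D * y ^+ 2 -> y.[0] != 0.
Proof.
move=> cE; apply: contra (crit_sqr_ndvd F n) => y0.
by rewrite cE dvdp_mull // dvdp_exp2r // -['X]subr0 -polyC0 dvdp_XsubCl.
Qed.

Lemma size_mul_sqr (D y : {poly F}) : D * y ^+ 2 != 0 ->
  (size (D * y ^+ 2)%R + 2 = size D + (size y).*2)%N.
Proof.
rewrite mulf_eq0 expf_eq0 /= => /norP[D0 y0].
rewrite expr2 !size_mul ?mulf_neq0 //.
have aux a b : (0 < a -> 0 < b -> (a + (b + b).-1).-1 + 2 = a + b.*2)%N by lia.
by apply: aux; rewrite size_poly_gt0.
Qed.

(** Multiply the derivative of the relation by [x] and subtract [2 x'] times the relation: the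
    right-hand sides are multiples of [h], and the terms in [x ^+ 2 * x'] cancel on the left. *)
Lemma deriv_conic (x q h w : {poly F}) : x ^+ 2 - w = q * h ^+ 2 ->
  2%:R * w * x^`() - w^`() * x
    = (x * (q^`() * h + 2%:R * q * h^`()) - 2%:R * q * h * x^`()) * h.
Proof.
move=> qE; have := congr1 (@deriv F) qE.
rewrite derivB derivM !deriv_exp /= !expr1 => dE.
transitivity (x * (x^`() * x *+ 2 - w^`()) - 2%:R * (x ^+ 2 - w) * x^`()).
  by ring.
by rewrite dE qE; ring.
Qed.

(* The two factors [u + X] and [u - X] of [c_n], for [u = x ^+ 2 - X ^+ 2], are
   [q * h ^+ 2] and [q1 * h1 ^+ 2].  Differentiating each gives a linear
   relation for [x] modulo [h] and modulo [h1]; eliminating [x'] leaves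
   [(X + 1) e h - (X - 1) f h1 = - 2 X x], and squaring it, with
   [2 X = q h ^+ 2 - q1 h1 ^+ 2], yields a quadratic form vanishing at
   [(h, h1)] whose coefficients have small degree. *)
Lemma conic_divides (X q q1 h h1 x xd e f : {poly F}) :
    x ^+ 2 - X ^+ 2 + X = q * h ^+ 2 -> x ^+ 2 - X ^+ 2 - X = q1 * h1 ^+ 2 ->
    2%:R * (X ^+ 2 - X) * xd - (2%:R * X - 1) * x = e * h ->
    2%:R * (X ^+ 2 + X) * xd - (2%:R * X + 1) * x = f * h1 ->
  h %| ((X - 1) ^+ 2 * f ^+ 2 + 2%:R * X ^+ 2 * (X - 1) * q1) * h1 ^+ 2.
Proof.
move=> qE q1E eE fE; apply/dvdpP.
exists (4%:R * X ^+ 2 * q * h + 2%:R * X ^+ 2 * (X - 1) * q * h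
   - (X + 1) ^+ 2 * e ^+ 2 * h + 2%:R * (X + 1) * (X - 1) * e * f * h1).
have sE : (X + 1) * (e * h) - (X - 1) * (f * h1) = - 2%:R * X * x.
  by rewrite -eE -fE; ring.
have tE : 2%:R * X = q * h ^+ 2 - q1 * h1 ^+ 2 by rewrite -qE -q1E; ring.
apply/eqP; rewrite -subr_eq0; apply/eqP.
transitivity (((X + 1) * (e * h) - (X - 1) * (f * h1)) ^+ 2
  - 4%:R * X ^+ 2 * x ^+ 2 + 4%:R * X ^+ 2 * (x ^+ 2 - X ^+ 2 + X - q * h ^+ 2)
  + 2%:R * X ^+ 2 * (X - 1) * (2%:R * X - (q * h ^+ 2 - q1 * h1 ^+ 2))).
  by ring.
by rewrite sE qE tE; ring.
Qed.

(** Arithmetic of sizes for [crit_nonsquare_large]: [K] is [2 ^ k.+1], the letters [d], [y], [h]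
    stand for the sizes of [D], [y], [h], while [q], [r], [c] stand for those of [q1], [f], [C'].
    The conclusion says that [('X - 1) * C'] is too small to be a nonzero multiple of [h]. *)
Lemma cofactor_degree d y h q r c K :
  (5 + 3 * d < 2 * K -> d + y.*2 = 2 * K + 3 -> y <= h -> q + h.*2 = 2 * K + 3 ->
   r = 0 \/ (r + h).-1 <= K + 2 -> c <= maxn r.*2 (q + 2) -> 1 + c < h)%N.
Proof. by lia. Qed.

Lemma crit_nonsquare_large k (D y : {poly F}) :
  c k.+3 = D * y ^+ 2 -> (5 + 3 * size D < 2 ^ k.+2)%N -> False.
Proof.
move=> cE D_small.
have y0 := crit_cofactor_at0 cE.
have two0 : 2%:R != 0 :> {poly F} by rewrite -polyC_natr polyC_eq0.
(* The substitution [t = - X ^+ 2] splits [c_n = u ^+ 2 + t]. *)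
pose s : {poly F} := - 'X ^+ 2.
have szs : size s = 3%N by rewrite size_polyN size_polyXn.
have szE p : (size (p \Po s)).-1 = ((size p).-1 * 2)%N.
  by rewrite size_comp_poly szs.
have unpred a b : (0 < b -> a.-1 = b -> a = b.+1)%N by clear; lia.
pose x := c k.+1 \Po s; pose u := c k.+2 \Po s.
pose Y := y \Po s.
have uE : u = x ^+ 2 - 'X ^+ 2.
  by rewrite /u critS comp_polyD comp_polyX rmorphXn.
have prodE : (D \Po s) * Y ^+ 2 = (u + 'X) * (u - 'X).
  rewrite /Y -rmorphXn -rmorphM /= -cE critS comp_polyD comp_polyX rmorphXn /=.
  by rewrite -/u /s; ring.
have Y0 : Y.[0] != 0 by rewrite horner_comp /s !hornerE expr0n oppr0.
(* Such a [d] divides [2 X], while [Y] is prime to ['X] because [Y.[0]] is nonzero. *)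
have cop2X d : d %| Y -> d %| u + 'X -> d %| u - 'X -> d %= 1.
  move=> dY dp dm; have dX : d %| 'X.
    rewrite -(dvdpZr _ _ two_neq0) scaler_nat mulr2n.
    by have := dvdp_sub dp dm; rewrite opprD opprK addrACA subrr add0r.
  by move/coprimep_X/coprimepP: Y0; apply.
pose h := gcdp Y (u + 'X); pose h1 := gcdp Y (u - 'X).
have [hY hp] : h %| Y /\ h %| u + 'X by rewrite dvdp_gcdl dvdp_gcdr.
have [h1Y h1m] : h1 %| Y /\ h1 %| u - 'X by rewrite dvdp_gcdl dvdp_gcdr.
have coph : coprimep h (u - 'X).
  by apply/coprimepP => d dh; apply: cop2X; apply: dvdp_trans dh _.
have coph1 : coprimep h1 (u + 'X).
  by apply/coprimepP => d dh1 dp; apply: cop2X dp _; apply: dvdp_trans dh1 _.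
have /dvdpP[q qE] : h ^+ 2 %| u + 'X.
  rewrite -(Gauss_dvdpl _ (coprimep_expl 2 coph)) -prodE.
  by rewrite dvdp_mull // dvdp_exp2r.
have /dvdpP[q1 q1E] : h1 ^+ 2 %| u - 'X.
  rewrite -(Gauss_dvdpr _ (coprimep_expl 2 coph1)) -prodE.
  by rewrite dvdp_mull // dvdp_exp2r.
have szN : size (- 'X : {poly F}) = 2%N by rewrite size_polyN size_polyX.
(* The substitution of [- 'X] for ['X] fixes [Y] and [u], hence exchanges [h] and [h1] up to a
   unit. *)
have h_h1 : size h = size h1.
  rewrite -(size_comp_poly2 h szN); apply: eqp_size.
  apply: eqp_trans (gcdp_comp_poly _ _ _) _.
  rewrite comp_polyD comp_polyX /Y /u -!comp_polyA.
  suff -> : s \Po (- 'X) = s by apply: eqpxx.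
  by rewrite /s rmorphN rmorphXn /= comp_polyX sqrrN.
have cop_hh1 : coprimep h h1.
  by apply: coprimep_dvdl coph.
have y_neq0 : y != 0 by apply: contraNneq y0 => ->; rewrite horner0.
have Y_neq0 : Y != 0 by apply: contraNneq Y0 => ->; rewrite horner0.
have h_neq0 : h != 0 by rewrite gcdp_eq0 negb_and Y_neq0.
have h1_neq0 : h1 != 0 by rewrite gcdp_eq0 negb_and Y_neq0.
have szx : size x = (2 ^ k.+1).+1.
  by apply: unpred; rewrite ?expn_gt0 // szE size_crit /= -expnSr.
have szu : size u = (2 ^ k.+2).+1.
  by apply: unpred; rewrite ?expn_gt0 // szE size_crit /= -expnSr.
have exp_gt1 : (1 < 2 ^ k.+2)%N by rewrite -{1}(expn0 2) ltn_exp2l.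
have szup : size (u + 'X) = (2 ^ k.+2).+1 by rewrite size_polyDl szu ?size_polyX.
have szum : size (u - 'X) = (2 ^ k.+2).+1.
  by rewrite size_polyDl szu ?size_polyN ?size_polyX.
have szY : (size Y = (size y).*2.-1)%N.
  have := szE y; rewrite -/Y; move: Y_neq0 y_neq0; rewrite -!size_poly_gt0.
  by move: (size Y) (size y) => a b; clear; lia.
(* [Y] has twice the degree of [y] and divides [h * h1], whose factors have equal degrees. *)
have szh : (size y <= size h)%N.
  have : Y %| h * h1 by apply: dvdp_mul_gcdp; rewrite -prodE dvdp_mull ?dvdp_exp.
  move/dvdp_leq; rewrite mulf_neq0 // size_mul // -h_h1 szY => /(_ isT).
  rewrite -!size_poly_gt0 in h_neq0 y_neq0 *; move: h_neq0 y_neq0.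
  by move: (size h) (size y) => a b; clear; lia.
have um_neq0 : u - 'X != 0 by rewrite -size_poly_eq0 szum.
have szq1 : (size q1 + (size h).*2 = 2 ^ k.+2 + 3)%N.
  rewrite h_h1 -size_mul_sqr -q1E // szum; clear; lia.
have szD : (size D + (size y).*2 = 2 ^ k.+2 + 3)%N.
  by rewrite -size_mul_sqr -cE ?crit_neq0 // size_crit; clear; lia.
(* [e] and [f] are the cofactors given by [deriv_conic] for [w = X ^+ 2 - X] and
   [w = X ^+ 2 + X]. *)
pose e := x * (q^`() * h + 2%:R * q * h^`()) - 2%:R * q * h * x^`().
pose f := x * (q1^`() * h1 + 2%:R * q1 * h1^`()) - 2%:R * q1 * h1 * x^`().
have xE : x ^+ 2 - 'X ^+ 2 + 'X = q * h ^+ 2 by rewrite -uE.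
have xE1 : x ^+ 2 - 'X ^+ 2 - 'X = q1 * h1 ^+ 2 by rewrite -uE.
have eE : 2%:R * ('X ^+ 2 - 'X) * x^`() - (2%:R * 'X - 1) * x = e * h.
  rewrite /e -(@deriv_conic x q h ('X ^+ 2 - 'X)); last by rewrite -xE; ring.
  by rewrite derivB derivXn derivX /= expr1; ring.
have fE : 2%:R * ('X ^+ 2 + 'X) * x^`() - (2%:R * 'X + 1) * x = f * h1.
  rewrite /f -(@deriv_conic x q1 h1 ('X ^+ 2 + 'X)); last by rewrite -xE1; ring.
  by rewrite derivD derivXn derivX /= expr1; ring.
have := conic_divides xE xE1 eE fE.
rewrite Gauss_dvdpl ?coprimep_pexpr //.
set C := _ + _ => hC.
have szXx m (p : {poly F}) : (size p <= m.+1 -> size (2%:R * p * x^`())%R <= m + 2 ^ k.+1)%N.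
  move=> le_p; rewrite -mulrA mulr_natl -scaler_nat size_scale //.
  apply: leq_trans (size_polyMleq _ _) _.
  have : (size x^`() <= 2 ^ k.+1)%N.
    by rewrite -ltnS -szx lt_size_deriv // -size_poly_eq0 szx.
  by move: (size p) (size x^`()) le_p => a b; clear; lia.
have szf : (size (f * h1)%R <= 2 ^ k.+1 + 2)%N.
  rewrite -fE (leq_trans (size_polyD _ _)) // geq_max addnC szXx /=; last first.
    by rewrite (leq_trans (size_polyD _ _)) // size_polyXn size_polyX.
  rewrite size_polyN (leq_trans (size_polyMleq _ _)) // szx addnS /=.
  rewrite leq_add2r (leq_trans (size_polyD _ _)) // geq_max size_poly1 andbT.
  by rewrite mulr_natl -scaler_nat size_scale // size_polyX.
have q1_neq0 : q1 != 0.
  by apply: contraNneq um_neq0 => q10; rewrite q1E q10 mul0r.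
have X1_neq0 : 'X - 1 != 0 :> {poly F} by rewrite polyXsubC_eq0.
have szX1 : size ('X - 1 : {poly F}) = 2%N by rewrite size_XsubC.
have szq1X : size (2%:R * 'X ^+ 2 * q1) = (size q1 + 2)%N.
  by rewrite -mulrA mulr_natl -scaler_nat size_scale // mulrC size_mulXn // addnC.
have szfX : f != 0 -> size (('X - 1) * f ^+ 2) = (size f).*2.
  move=> f0; rewrite size_mul ?expf_eq0 // expr2 size_mul // szX1.
  by move: f0; rewrite -size_poly_gt0; move: (size f); clear; lia.
have : C = ('X - 1) * (('X - 1) * f ^+ 2 + 2%:R * 'X ^+ 2 * q1).
  by rewrite /C; ring.
set C' := _ + 2%:R * _ * _ => CE.
(* Otherwise [C = ('X - 1) * C'] would be a nonzero multiple of [h] of smaller size than [h]. *)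
have C'0 : C' = 0.
  apply/eqP; apply: contraTT hC => C'_neq0; apply/negP => /dvdp_leq.
  rewrite CE mulf_neq0 // => /(_ isT); apply/negP; rewrite -ltnNge.
  rewrite size_mul // szX1 /=.
  have : (size C' <= maxn (size (('X - 1) * f ^+ 2)%R) (size q1 + 2))%N.
    by rewrite -szq1X; apply: size_polyD.
  have hr : size f = 0%N \/ ((size f + size h).-1 <= 2 ^ k.+1 + 2)%N.
    have [->|f0] := eqVneq f 0; first by left; rewrite size_poly0.
    by right; rewrite h_h1 -size_mul.
  move=> szC'; apply: cofactor_degree szh _ hr _; rewrite -?expnS;
    [exact: D_small | exact: szD | exact: szq1 |].
  have [f0|/szfX <- //] := eqVneq f 0.
  by move: szC'; rewrite f0 expr0n mulr0 size_poly0.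
(* The two sides of [C' = 0] have sizes of opposite parity. *)
have f0 : f != 0.
  apply: contraTneq q1_neq0 => f0; move: C'0; rewrite /C' f0 expr0n mulr0 add0r.
  by move/eqP; rewrite -size_poly_eq0 szq1X addn2.
move/eqP: C'0; rewrite addr_eq0 => /eqP/(congr1 (fun p : {poly F} => size p)).
rewrite size_polyN szfX // szq1X; move: szq1; rewrite !expnS; clear; lia.
Qed.

(** Here [d] and [y] are the sizes of [D] and [y]. For positive [n] the equation makes [d] odd,
    which together with [d != 1] settles [n = 1] and [n = 2], and sharpens the bound enough at
    [n = 4]. At [n = 3] the value [d = 3] survives and violates the inequality. *)
Lemma cofactor_small n d y :
    (d + y.*2 = 2 ^ n + 3 -> d <= 2 ^ n.+1./2 -> n != 3 -> 0 < d -> d != 1 ->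
  exists2 k, n = k.+2 & 5 + 3 * d < 2 ^ n)%N.
Proof.
move=> dy d_le n3 d0 d1.
case: n => [|[|[|[|n]]]] // in dy d_le n3 *.
- by exfalso; move: dy d_le; rewrite /= expn0; lia.
- by exfalso; move: dy d_le; rewrite /= expn1; lia.
- by exfalso; move: dy d_le; rewrite /= !expnS expn0; lia.
exists n.+2 => //; case: n => [|[|n]] in dy d_le n3 *;
  try by move: dy d_le; rewrite /= !expnS expn0; lia.
have : (2 ^ n.+4.+3./2 <= 2 ^ n.+3)%N by rewrite leq_exp2l //; lia.
by move: d_le (expn_gt0 2 n); rewrite !expnS; lia.
Qed.

Lemma crit_nonsquare n (D y : {poly F}) : c n.+1 = D * y ^+ 2 ->
  (size D <= 2 ^ n.+1./2)%N -> n != 3%N -> False.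
Proof.
move=> cE D_small n_neq3.
have D_neq0 : D != 0.
  by apply: contraNneq (crit_neq0 F n) => D0; rewrite cE D0 mul0r.
have szD : (size D + (size y).*2 = 2 ^ n + 3)%N.
  by rewrite -size_mul_sqr -cE ?crit_neq0 // size_crit; clear; lia.
(* A constant [D] is impossible: ['X] divides [c n.+1] but is coprime to [y]. *)
have : size D != 1%N.
  apply/negP => /size_poly1P[a a0 DE].
  move/coprimep_X: (crit_cofactor_at0 cE); rewrite coprimep_sym => copX.
  have : 'X %| c n.+1.
    by rewrite -['X]subr0 -polyC0 dvdp_XsubCl /root crit_at0.
  rewrite cE DE Gauss_dvdpl ?coprimep_expr // => /dvdp_leq.
  by rewrite polyC_eq0 size_polyX size_polyC a0 => /(_ isT).
rewrite -size_poly_gt0 in D_neq0.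
move=> D_neq1; have [k nE large] := cofactor_small szD D_small n_neq3 D_neq0 D_neq1.
by rewrite nE in cE large; apply: crit_nonsquare_large cE large.
Qed.

(* Level 4 is too small for the degree bound in [crit_nonsquare_large]. *)
Lemma crit4_nonsquare (a : F) (B g : {poly F}) :
  c 4 = c 2 * B -> B <> a *: g ^+ 2.
Proof.
move=> c4E gE.
have BE : B = 'X^6 + 'X^5 *+ 3 + 'X^4 *+ 3 + 'X^3 *+ 3 + 'X^2 *+ 2 + 1.
  apply: (mulfI (crit_neq0 F 1)); rewrite -c4E.
  have c2E : c 2 = 'X ^+ 2 + 'X by rewrite /crit /= expr0n add0r.
  by rewrite critS critS c2E; ring.
have szB : size B = 7%N.
  apply/eqP; rewrite -(eqn_add2l (size (c 2)).-1).
  have : size (c 2 * B) = 9%N by rewrite -c4E size_crit.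
  have [B0|B0] := eqVneq B 0; first by rewrite B0 mulr0 size_poly0.
  by rewrite size_mul ?crit_neq0 // size_crit /= => ->.
have B_neq0 : B != 0 by rewrite -size_poly_eq0 szB.
have g4 : g`_4 = 0.
  apply/nth_default; have := size_mul_sqr (D := a%:P) (y := g).
  rewrite mul_polyC -gE szB => /(_ B_neq0) szg.
  have aux r m : (r <= 1 -> 7 + 2 = r + m.*2 -> m <= 4)%N by clear; lia.
  by apply: aux szg; apply: size_polyC_leq1.
have coefB i : a * (g * g)`_i = B`_i by rewrite gE expr2 coefZ.
have := (coefB 0%N, coefB 1%N, coefB 2%N, coefB 4%N).
rewrite !coefM !big_ord_recr !big_ord0 /= !subn0 BE g4 !(coefD, coefMn, coefXn, coef1) /=.
rewrite !subSS !subn0 !(mul0rn, add0r, addr0, mulr0, mul0r).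
case=> [[[e0 e1] e2] e4].
have {}e0 : a * (g`_0 * g`_0) = 1 := e0.
have {}e1 : a * (g`_0 * g`_1 + g`_1 * g`_0) = 0 := e1.
have {}e2 : a * (g`_0 * g`_2 + g`_1 * g`_1 + g`_2 * g`_0) = 1 + 1 := e2.
have {}e4 : a * (g`_1 * g`_3 + g`_2 * g`_2 + g`_3 * g`_1) = 1 + (1 + 1) := e4.
have [a0 g0] : a != 0 /\ g`_0 != 0.
  split; first by apply: contra_eq_neq e0 => ->; rewrite mul0r eq_sym oner_eq0.
  by apply: contra_eq_neq e0 => ->; rewrite !mulr0 eq_sym oner_eq0.
have g1 : g`_1 = 0.
  have /eqP : 2%:R * (a * g`_0 * g`_1) = 0 by rewrite -[RHS]e1; ring.
  by rewrite !mulf_eq0 (negPf two_neq0) (negPf a0) (negPf g0) => /eqP.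
have e2' : a * (g`_0 * g`_2) = 1.
  apply: (mulfI two_neq0); rewrite mulr1 -[RHS]/(1 + 1) -e2 g1; ring.
move/eqP: two_neq0; apply.
(* With [g1 = 0], the coefficients give [a g0^2 = 1], [a g0 g2 = 1] and [a g2^2 = 3]; the product of
   the first and third equals the square of the second, so 3 = 1. *)
have -> : 2%:R = (a * (g`_0 * g`_0)) * (1 + (1 + 1)) - (a * (g`_0 * g`_2)) ^+ 2.
  by rewrite e0 e2'; ring.
by rewrite -e4 g1; ring.
Qed.

(** A part [B] of [c n.+1] coprime to all the other factors must itself be a square up to a
    constant, by [coprimep_sqr]. The remaining cofactor of [c n.+1] is then small, against
    [crit_nonsquare]. *)
Lemma crit_prod_nonsquare n (S : pred nat) (a : F) (q r : {poly F}) :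
  a != 0 -> r != 0 ->
  q ^+ 2 <> a *: (c n.+1 * \prod_(i < n | S i) c i.+1) * r ^+ 2.
Proof.
move=> a0 r0 qE.
have sqr_part B R : c n.+1 = B * R -> coprimep B R ->
    (forall m, (0 < m < n.+1)%N -> coprimep B (c m)) ->
    exists b g, b != 0 /\ B = b *: g ^+ 2.
  move=> cE copBR copB.
  apply: (@coprimep_sqr _ B (a *: (R * \prod_(i < n | S i) c i.+1)) q r) => //.
    rewrite coprimepZr // coprimepMr copBR /=.
    apply: (big_ind (coprimep B)) => [|p s Bp Bs|i _].
    - by rewrite coprimep1.
    - by rewrite coprimepMr Bp.
    - by apply: (copB i.+1); rewrite /= ltnS.
  by rewrite qE cE; congr (_ * _); rewrite -scalerAr mulrA.
(* For [c 4] the coprime part is [c 4 / c 2], handled by explicit coefficients; the gcd of 4 with 1,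
   2 or 3 is 1 or 2, and [c 1] divides [c 2]. *)
have [n3|n3] := eqVneq n 3%N.
  have [u uE copu] := @crit_dvd_coprime F 2 4 isT isT isT.
  have [| |m m_lt|b [g [_ /(crit4_nonsquare uE)]]] // := sqr_part u (c 2).
    by rewrite n3 uE mulrC.
  apply/coprimepP => d du dm; move/coprimepP: copu; apply=> //.
  have : d %| c (gcdn m 4) by apply: crit_dvd_gcd; rewrite // uE dvdp_mull.
  rewrite n3 in m_lt; case: m m_lt {dm} => [|[|[|[|m]]]] //= _ d_dv.
  - have [w wE _] := @crit_dvd_coprime F 1 2 isT isT isT.
    by rewrite wE dvdp_mulr.
  - have [w wE _] := @crit_dvd_coprime F 1 2 isT isT isT.
    by rewrite wE dvdp_mulr.
have [B [R [cE copBR szR copB]]] := crit_primitive_part F (ltn0Sn n).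
have [b [g [b0 BE]]] := sqr_part B R cE copBR copB.
apply: (@crit_nonsquare n (b *: R) g) => //; last by rewrite size_scale.
by rewrite cE BE -scalerAl -scalerAl mulrC.
Qed.

End Core.

(** * Flips of sibling nodes *)

Lemma F2_natr_addb (a b : bool) : (a (+) b)%:R = a%:R + b%:R :> 'F_2.
Proof. by case: a; case: b; apply/val_inj. Qed.

Lemma F2_natr_bool (x : 'F_2) : x = (x != 0)%:R.
Proof. by apply/val_inj; case: x => [[|[|x]] ?]. Qed.

(** Over F_2 an additively closed set containing 0 is a subspace. Its elements are stacked as the
    rows of a matrix; the columns of the cokernel are orthogonal to all of them, hence zero, so the
    rows span everything. *)
Lemma F2_subspace_full N (A : 'rV['F_2]_N -> Prop) :
    A 0 -> (forall u v, A u -> A v -> A (u + v)) ->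
    (forall v : 'cV_N, (forall u, A u -> u *m v = 0) -> v = 0) ->
  forall u, A u.
Proof.
move=> A0 AD Adual u; pose s := [seq w <- enum 'rV['F_2]_N | `[< A w >]].
have sA w : w \in s -> A w by rewrite mem_filter => /andP[/asboolP].
pose M : 'M['F_2]_(size s, N) := \matrix_i s`_i.
have rowM i : A (row i M) by rewrite rowK; apply/sA/mem_nth.
have cok0 : cokermx M = 0.
  apply/matrixP => i j; transitivity (col j (cokermx M) i 0); first by rewrite [RHS]mxE.
  suff -> : col j (cokermx M) = 0 by rewrite !mxE.
  apply: Adual => w Aw.
  have /(nthP 0)[k k_lt <-] : w \in s.
    by rewrite mem_filter mem_enum andbT; apply/asboolP.
  have -> : s`_k = row (Ordinal k_lt) M by rewrite rowK.
  by rewrite colE mulmxA -row_mul mulmx_coker row0 mul0mx.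
have /submxP[D ->] : (u <= M)%MS by rewrite submxE cok0 mulmx0.
rewrite mulmx_sum_row; apply: big_ind => // i _.
rewrite [D 0 i]F2_natr_bool; case: (_ != 0); last by rewrite scale0r.
by rewrite scale1r.
Qed.

(** * A group acting on the preimage tree *)

Section TreeGroup.

Variables (L : fieldType) (t : L) (Gam : {rmorphism L -> L} -> Prop).
Variable sq : L -> L.
Hypothesis two_neq0 : 2%:R != 0 :> L.
Hypothesis sqK : forall x, sq x ^+ 2 = x.
Hypothesis Gam_id : Gam idfun.
Hypothesis GamM : forall g h, Gam g -> Gam h -> Gam (g \o h).
Hypothesis GamV : forall g, Gam g ->
  exists g' : {rmorphism L -> L}, [/\ Gam g', cancel g g' & cancel g' g].
Hypothesis Gam_t : forall g, Gam g -> g t = t.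
Hypothesis crit_t : forall n, (crit L n.+1).[t] != 0.

Definition qmap (x : L) := x ^+ 2 + t.

Fixpoint nodes n : seq L :=
  if n is n'.+1 then
    flatten [seq [:: sq (b - t); - sq (b - t)] | b <- nodes n'] else [:: 0].

Lemma qmap_inj x y : qmap x = qmap y -> y = x \/ y = - x.
Proof.
move/addIr/eqP; rewrite eqf_sqr => /orP[] /eqP ->; first by left.
by right; rewrite opprK.
Qed.

Lemma qmap_sq b : qmap (sq (b - t)) = b.
Proof. by rewrite /qmap sqK subrK. Qed.

Lemma qmapN x : qmap (- x) = qmap x.
Proof. by rewrite /qmap sqrrN. Qed.

Lemma sq_qmapP v : sq (qmap v - t) = v \/ sq (qmap v - t) = - v.
Proof. exact/qmap_inj/esym/qmap_sq. Qed.

Lemma mem_nodesS n x : (x \in nodes n.+1) = (qmap x \in nodes n).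
Proof.
apply/flatten_mapP/idP => [[b b_n]|x_n].
  by rewrite !inE => /orP[] /eqP->; rewrite ?qmapN qmap_sq.
exists (qmap x) => //; rewrite !inE.
by have [->|->] := sq_qmapP x; rewrite ?opprK eqxx ?orbT.
Qed.

Lemma mem_nodes n x : (x \in nodes n) = (iter n qmap x == 0).
Proof. by elim: n x => [|n IHn] x; rewrite ?inE // mem_nodesS IHn iterSr. Qed.

Lemma iter_qmap_crit n : iter n qmap t = (crit L n.+1).[t].
Proof.
elim: n => [|n IHn]; first by rewrite /crit /= expr0n add0r hornerX.
by rewrite critS hornerD horner_exp hornerX -IHn.
Qed.

(** This keeps the two children of a node distinct: [b = t] would make the critical value [c_{n+1}]
    vanish at [t]. *)
Lemma nodes_neq_t n b : b \in nodes n -> b - t != 0.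
Proof.
rewrite mem_nodes subr_eq0; apply: contraTneq => ->.
by rewrite iter_qmap_crit crit_t.
Qed.

Lemma nodes_neq0 n v : v \in nodes n.+1 -> v != 0.
Proof.
rewrite mem_nodesS => /nodes_neq_t; rewrite /qmap addrK.
by rewrite expf_eq0.
Qed.

Lemma neq_opp (x : L) : x != 0 -> x != - x.
Proof.
by move=> x0; rewrite -subr_eq0 opprK -mulr2n -mulr_natl mulf_neq0.
Qed.

Lemma nodes_uniq n : uniq (nodes n).
Proof.
elim: n => //= n; have : {subset nodes n <= nodes n} by [].
elim: {-2}(nodes n) => //= b r IHr sub /andP[b_r r_uniq].
have b_n : b \in nodes n by rewrite sub ?mem_head.
rewrite inE negb_or neq_opp; last first.
  by apply: (@nodes_neq0 n); rewrite mem_nodesS qmap_sq.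
have sub' : {subset r <= nodes n} by move=> i i_r; rewrite sub // inE i_r orbT.
have notin v : qmap v = b -> v \notin flatten [seq [:: sq (b - t); - sq (b - t)] | b <- r].
  move=> vb; apply: contra b_r => /flatten_mapP[b' b'r].
  by rewrite !inE => /orP[] /eqP vE; rewrite -vb vE ?qmapN qmap_sq.
by rewrite !notin ?qmapN ?qmap_sq //= IHr.
Qed.

(** At [z = t] this evaluates, up to sign, the square of [sqrt_prod n] as a critical value. *)
Lemma prod_nodes n z : \prod_(b <- nodes n) (z - b) = iter n qmap z.
Proof.
elim: n z => [|n IHn] z; first by rewrite big_seq1 subr0.
rewrite iterSr -IHn big_flatten big_map; apply: eq_bigr => b _.
rewrite big_cons big_seq1 /=; transitivity (z ^+ 2 - sq (b - t) ^+ 2); first by ring.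
by rewrite sqK /qmap; ring.
Qed.

Lemma Gam_qmap g x : Gam g -> g (qmap x) = qmap (g x).
Proof. by move=> Gg; rewrite rmorphD rmorphXn Gam_t. Qed.

Lemma Gam_iter g n x : Gam g -> g (iter n qmap x) = iter n qmap (g x).
Proof. by move=> Gg; elim: n => //= n <-; rewrite Gam_qmap. Qed.

Lemma Gam_nodes g n b : Gam g -> (g b \in nodes n) = (b \in nodes n).
Proof. by move=> Gg; rewrite !mem_nodes -Gam_iter // fmorph_eq0. Qed.

Lemma Gam_perm g n : Gam g -> perm_eq (map g (nodes n)) (nodes n).
Proof.
move=> Gg; have gu : uniq (map g (nodes n)).
  by rewrite map_inj_uniq ?nodes_uniq //; apply: fmorph_inj.
apply: uniq_perm; rewrite ?nodes_uniq //.
apply: (uniq_min_size gu _ _).2; rewrite ?size_map //.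
by move=> _ /mapP[b b_n ->]; rewrite Gam_nodes.
Qed.

Definition fixes (g : L -> L) n := forall b, b \in nodes n -> g b = b.
(* [sq (b - t)] and its opposite are the two children of [b]; an automorphism
   that fixes [b] either fixes both or exchanges them. *)
Definition flips (g : L -> L) b := g (sq (b - t)) != sq (b - t).

Lemma fixesS g n : Gam g -> fixes g n.+1 -> fixes g n.
Proof.
move=> Gg fg b b_n; rewrite -[b in LHS]qmap_sq Gam_qmap // fg ?qmap_sq //.
by rewrite mem_nodesS qmap_sq.
Qed.

Lemma fixes_le g m n : Gam g -> (m <= n)%N -> fixes g n -> fixes g m.
Proof.
move=> Gg; elim: n => [|n IHn]; first by rewrite leqn0 => /eqP->.
by rewrite leq_eqVlt => /orP[/eqP->//|/IHn IH /fixesS/(_)/IH]; apply.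
Qed.

Lemma flipsE g n b : Gam g -> fixes g n -> b \in nodes n ->
  g (sq (b - t)) = (-1) ^+ flips g b * sq (b - t).
Proof.
move=> Gg fg b_n; rewrite /flips; case: eqVneq => [->|]; first by rewrite mul1r.
have : qmap (sq (b - t)) = qmap (g (sq (b - t))) by rewrite -Gam_qmap // qmap_sq fg.
by case/qmap_inj=> -> //; [rewrite eqxx | rewrite mulN1r].
Qed.

Lemma flips_eq g b (e : bool) n : b \in nodes n ->
  g (sq (b - t)) = (-1) ^+ e * sq (b - t) ->
  flips g b = e.
Proof.
move=> b_n; rewrite /flips => ->; case: e; rewrite ?mul1r ?eqxx // mulN1r eq_sym.
by apply: neq_opp; apply: (@nodes_neq0 n); rewrite mem_nodesS qmap_sq.
Qed.

Definition all_flips n := forall e : L -> bool, exists g : {rmorphism L -> L},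
  [/\ Gam g, fixes g n & forall b, b \in nodes n ->
       g (sq (b - t)) = (-1) ^+ e b * sq (b - t)].

Lemma flip_all n : all_flips n -> exists h : {rmorphism L -> L},
  [/\ Gam h, fixes h n & forall v, v \in nodes n.+1 -> h v = - v].
Proof.
case/(_ (fun=> true))=> h [Gh fh hE]; exists h; split=> // v.
rewrite mem_nodesS => /hE; rewrite mulN1r => vE.
have [E|E] := sq_qmapP v; rewrite E in vE => //.
by apply: oppr_inj; rewrite -rmorphN vE opprK.
Qed.

(** An element matching the parents sends [a] to [b] or to [- b]; in the second case the exchange of
    all siblings corrects it. *)
Lemma Gam_trans n a b : (forall m, (m < n)%N -> all_flips m) ->
  a \in nodes n -> b \in nodes n -> exists2 g : {rmorphism L -> L}, Gam g & g a = b.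
Proof.
elim: n a b => [|n IHn] a b Fn; first by rewrite !inE => /eqP-> /eqP->; exists idfun.
rewrite !mem_nodesS => a_n b_n.
have [m m_n|g Gg gE] := IHn _ _ _ a_n b_n; first by apply: Fn; rewrite ltnW.
have [h [Gh fh hE]] := flip_all (Fn n (ltnSn n)).
have : qmap b = qmap (g a) by rewrite -Gam_qmap.
case/qmap_inj=> gaE; first by exists g.
exists (h \o g); first exact: GamM.
by rewrite /= gaE rmorphN hE ?opprK // mem_nodesS.
Qed.

(* The predicates [S] orthogonal, over F_2, to all the flip vectors realised
   at level [n]; the group acts on them, and [all_flips n] says that only the
   zero predicate is orthogonal. *)
Definition even_flips n (S : L -> bool) := forall g : {rmorphism L -> L}, Gam g -> fixes g n ->
  \big[addb/false]_(b <- nodes n) (S b && flips g b) = false.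

Lemma eq_even_flips n S S' : {in nodes n, S =1 S'} -> even_flips n S -> even_flips n S'.
Proof.
by move=> SS' WS g Gg fg; rewrite -[RHS](WS g) //; apply: eq_big_seq => b /SS' ->.
Qed.

Lemma even_flips_addb n S S' : 
  even_flips n S -> even_flips n S' -> even_flips n (fun b => S b (+) S' b).
Proof.
move=> WS WS' g Gg fg; under eq_bigr do rewrite andb_addl.
by rewrite big_split /= WS ?WS'.
Qed.

(** [h] may send the chosen square root to the opposite of the chosen one, but a conjugate acts by
    the same sign on both. *)
Lemma flips_conj (g h h' : {rmorphism L -> L}) n b :
    Gam g -> fixes g n -> Gam h -> cancel h h' -> b \in nodes n ->
  flips (h \o (g \o h')) (h b) = flips g b.
Proof.
move=> Gg fg Gh hK b_n; apply: (@flips_eq _ _ _ n); rewrite ?Gam_nodes //=.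
have : qmap (sq (h b - t)) = qmap (h (sq (b - t))) by rewrite -Gam_qmap // !qmap_sq.
have hg : h (g (h' (h (sq (b - t))))) = (-1) ^+ flips g b * h (sq (b - t)).
  by rewrite hK (flipsE Gg fg b_n) rmorphM rmorph_sign.
case/qmap_inj=> E; rewrite E in hg; first by [].
by move: hg; rewrite !rmorphN mulrN => /oppr_inj.
Qed.

Lemma flips_comp (g h : {rmorphism L -> L}) n b :
    Gam g -> fixes g n -> Gam h -> fixes h n -> b \in nodes n ->
  flips (g \o h) b = flips g b (+) flips h b.
Proof.
move=> Gg fg Gh fh b_n; apply: (@flips_eq _ _ _ n) => //=.
by rewrite (flipsE Gh fh) // rmorphM rmorph_sign (flipsE Gg fg) // mulrA -signr_addb addbC.
Qed.

Lemma even_flips_conj n S h : Gam h -> even_flips n S -> even_flips n (S \o h).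
Proof.
move=> Gh WS g Gg fg; have [h' [Gh' hK h'K]] := GamV Gh.
have Gghh : Gam (h \o (g \o h')) by do 2?apply: GamM.
have fixh : fixes (h \o (g \o h')) n.
  by move=> b b_n; rewrite /= fg ?h'K ?Gam_nodes.
rewrite -[RHS](WS _ Gghh fixh) -[RHS](perm_big _ (Gam_perm n Gh)) big_map.
by apply: eq_big_seq => b b_n /=; rewrite (flips_conj Gg fg Gh hK b_n).
Qed.

(* A nonzero orthogonal [S] is made constant on the fibres over lower and lower
   levels, adding to it its image under the exchange of all siblings whenever
   it is not already constant on siblings. *)
Lemma even_flips_all n S : (forall m, (m < n)%N -> all_flips m) ->
  even_flips n S -> (exists2 b, b \in nodes n & S b) -> even_flips n (fun=> true).
Proof.
move=> Fn WS exS.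
(* Downward induction on the level [j] to which the predicate belongs; it is pulled back to level
   [n] along [qmap], and at [j = 0] it is constantly true. *)
suff H j (S' : L -> bool) : (j <= n)%N -> even_flips n (S' \o iter (n - j) qmap) ->
    (exists2 b, b \in nodes j & S' b) -> even_flips n (fun=> true).
  by apply: (H n S) => //; rewrite subnn.
elim: j S' {S WS exS} => [|j IHj] S j_n WS [b b_j Sb].
  apply: eq_even_flips WS => v; rewrite subn0 mem_nodes /= => /eqP->.
  by move: b_j Sb; rewrite inE => /eqP->.
have iter_rs v : v \in nodes n -> iter (n - j.+1) qmap v \in nodes j.+1.
  by rewrite !mem_nodes -iterD subnKC.
have iterE v : iter (n - j) qmap v = qmap (iter (n - j.+1) qmap v) by rewrite -iterS subnSK.
case: (pselect (exists2 v, v \in nodes j.+1 & S v != S (- v))) => [[v v_j Sv]|eqS].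
  have [h [Gh fh hE]] := flip_all (Fn j j_n).
  have := even_flips_addb WS (even_flips_conj Gh WS).
  pose S' b := S (sq (b - t)) (+) S (- sq (b - t)).
  move=> WS'; apply: (IHj S' (ltnW j_n)).
    apply: eq_even_flips WS' => w /iter_rs w_j; rewrite /= iterE -Gam_iter //= hE // /S'.
    have [->|->] := sq_qmapP (iter (n - j.+1) qmap w); rewrite ?opprK //.
    by rewrite addbC.
  exists (qmap v); first by rewrite -mem_nodesS.
  rewrite /S'; move: Sv; have [->|->] := sq_qmapP v; rewrite ?opprK;
  by case: (S _); case: (S _).
pose S' b := S (sq (b - t)); have S'E v : v \in nodes j.+1 -> S' (qmap v) = S v.
  move=> v_j; rewrite /S'; have [->//|->] := sq_qmapP v.
  by apply/eqP; apply: contra_notT eqS => neS; exists v; rewrite // eq_sym.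
apply: (IHj S' (ltnW j_n)).
  by apply: eq_even_flips WS => w /iter_rs w_j; rewrite /= iterE S'E.
by exists (qmap b); rewrite -?mem_nodesS ?S'E.
Qed.

Definition sqrt_prod n := \prod_(b <- nodes n) sq (b - t).

Lemma sqrt_prod_neq0 n : sqrt_prod n != 0.
Proof.
rewrite /sqrt_prod prodf_seq_neq0; apply/allP => b b_n /=.
by apply: (@nodes_neq0 n); rewrite mem_nodesS qmap_sq.
Qed.

Lemma Gam_sqrt_prod g n : Gam g -> fixes g n ->
  g (sqrt_prod n) = (-1) ^+ (\big[addb/false]_(b <- nodes n) flips g b) * sqrt_prod n.
Proof.
move=> Gg fg; rewrite /sqrt_prod rmorph_prod.
rewrite (eq_big_seq _ (fun b b_n => flipsE Gg fg b_n)) big_split /=; congr (_ * _).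
by elim: (nodes n) => [|b r IHr]; rewrite ?big_nil // !big_cons IHr signr_addb.
Qed.

Lemma sqrt_prod_sqr n : sqrt_prod n ^+ 2 = (-1) ^+ size (nodes n) * (crit L n.+1).[t].
Proof.
rewrite -iter_qmap_crit -prod_nodes -prodrXl.
elim: (nodes n) => [|b r IHr]; first by rewrite !big_nil mulr1.
by rewrite !big_cons IHr sqK exprS /=; ring.
Qed.

Lemma Gam_sqrt_prod_sqr g n : Gam g -> g (sqrt_prod n ^+ 2) = sqrt_prod n ^+ 2.
Proof.
move=> Gg; rewrite -prodrXl rmorph_prod -[RHS](perm_big _ (Gam_perm n Gg)) big_map.
by apply: eq_bigr => b _; rewrite !sqK rmorphB Gam_t.
Qed.

(** By [flips_comp] the realised flip vectors form a subspace of F_2^N, to which [F2_subspace_full]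
    applies. *)
Lemma all_flips_dual n :
  (forall S, even_flips n S -> forall b, b \in nodes n -> S b = false) -> all_flips n.
Proof.
move=> Wn e; set N := size (nodes n).
pose A (u : 'rV['F_2]_N) := exists g : {rmorphism L -> L},
  [/\ Gam g, fixes g n & forall i : 'I_N, u 0 i = (flips g (nodes n)`_i)%:R].
have [] : A (\row_i (e (nodes n)`_i)%:R).
  apply: F2_subspace_full => [|u v [g [Gg fg gE]] [h [Gh fh hE]]|v Av].
  - by exists idfun; split=> // i; rewrite mxE /flips eqxx.
  - exists (g \o h); split=> [||i]; first exact: GamM.
      by move=> b b_n; rewrite /= fh ?fg.
    have i_n : (nodes n)`_i \in nodes n by rewrite mem_nth.
    by rewrite mxE gE hE -F2_natr_addb (flips_comp Gg fg Gh fh).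
  pose S b := if insub (index b (nodes n)) is Some i then v i 0 != 0 else false.
  have SE (i : 'I_N) : S (nodes n)`_i = (v i 0 != 0).
    by rewrite /S index_uniq ?nodes_uniq // valK.
  suff WS : even_flips n S.
    apply/colP => i; have := Wn S WS _ (mem_nth 0 (ltn_ord i)).
    by rewrite SE mxE => /negbFE/eqP.
  move=> g Gg fg; have := Av (\row_i (flips g (nodes n)`_i)%:R).
  have A_g : A (\row_i (flips g (nodes n)`_i)%:R) by exists g; split=> // i; rewrite mxE.
  move=> /(_ A_g)/matrixP/(_ 0 0); rewrite !mxE => sum0.
  have {}sum0 : (\big[addb/false]_(b <- nodes n) (S b && flips g b))%:R = 0 :> 'F_2.
    rewrite -sum0 (big_nth 0) big_mkord.
    rewrite (big_morph (fun b : bool => b%:R) F2_natr_addb (erefl _)).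
    apply: eq_bigr => i _; rewrite mxE SE [v i 0 in RHS]F2_natr_bool.
    by case: (_ != 0); case: flips; rewrite ?(mulr0, mulr1).
  by case: (\big[_/_]_(_ <- _) _) sum0.
move=> g [Gg fg gE]; exists g; split=> // b b_n.
have b_lt : (index b (nodes n) < N)%N by rewrite index_mem.
have := gE (Ordinal b_lt); rewrite mxE /= nth_index // => /(congr1 (fun x => x == 0)).
rewrite (flipsE Gg fg b_n); case: (e b); case: (flips g b) => //=.
Qed.

(* Going one level down, the sign by which [s] changes under the flip of a
   single node does not depend on the node, by transitivity; if it is -1, then
   multiplying [s] by [sqrt_prod n] corrects it. *)
Lemma fixed_descend n (s : L) : (forall m, (m < n)%N -> all_flips m) ->
    (forall g, Gam g -> g (s ^+ 2) = s ^+ 2) ->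
    (forall g, Gam g -> fixes g n -> g s = s) ->
  exists S : pred nat, forall g, Gam g ->
    g (s * \prod_(i < n | S i) sqrt_prod i) = s * \prod_(i < n | S i) sqrt_prod i.
Proof.
elim: n s => [|n IHn] s Fn s2 fs.
  exists pred0 => g Gg; rewrite big_ord0 mulr1 fs // => b.
  by rewrite inE => /eqP->; rewrite rmorph0.
have {}IHn s' := IHn s' (fun m m_n => Fn m (ltnW m_n)).
have Fn' := Fn n (ltnSn n).
have sgn g : Gam g -> g s = s \/ g s = - s.
  move=> Gg; have := s2 g Gg; rewrite rmorphXn => /eqP.
  by rewrite eqf_sqr => /orP[]/eqP; [left | right].
(* The quotient of [g] and [h] fixes level [n + 1], hence fixes [s]. *)
have same_fl (g h : {rmorphism L -> L}) : Gam g -> Gam h -> fixes g n -> fixes h n ->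
    {in nodes n, flips g =1 flips h} -> g s = h s.
  move=> Gg Gh fg fh ghE; have [h' [Gh' hK h'K]] := GamV Gh.
  rewrite -[g s]h'K; congr (h _).
  have Gh'g : Gam (h' \o g) by apply: GamM.
  apply: (fs _ Gh'g) => v; rewrite mem_nodesS => v_n /=.
  apply: (can_inj hK); rewrite h'K.
  have E : g (sq (qmap v - t)) = h (sq (qmap v - t)).
    by rewrite (flipsE Gg fg v_n) (flipsE Gh fh v_n) ghE.
  have [vE|vE] := sq_qmapP v; rewrite vE in E => //.
  by apply: oppr_inj; rewrite -!rmorphN.
have one_flip b : b \in nodes n -> exists g : {rmorphism L -> L},
    [/\ Gam g, fixes g n & {in nodes n, flips g =1 pred1 b}].
  move=> b_n; have [g [Gg fg gE]] := Fn' (pred1 b); exists g; split=> // x x_n.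
  by apply: (@flips_eq _ _ _ n) => //; apply: gE.
have [b0 b0_n] : exists b0, b0 \in nodes n.
  elim: {Fn IHn fs same_fl Fn' one_flip}(n) => [|m [b b_m]]; first by exists 0; rewrite inE.
  by exists (sq (b - t)); rewrite mem_nodesS qmap_sq.
have [g0 [Gg0 fg0 g0E]] := one_flip b0 b0_n.
have [chi g0s] : exists chi : bool, g0 s = (-1) ^+ chi * s.
  by have [->|->] := sgn g0 Gg0; [exists false | exists true]; rewrite ?mul1r ?mulN1r.
(* A flip at [b] has the same effect on [s] as a conjugate of [g0]; conjugation keeps the sign,
   since every element sends [s] to [s] or [- s]. *)
have gs (g : {rmorphism L -> L}) b : Gam g -> fixes g n -> b \in nodes n ->
    {in nodes n, flips g =1 pred1 b} -> g s = (-1) ^+ chi * s.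
  move=> Gg fg b_n gE.
  have [h Gh hb] := Gam_trans (fun m m_n => Fn m (ltnW m_n)) b0_n b_n.
  have [h' [Gh' hK h'K]] := GamV Gh.
  have Gc : Gam (h \o (g0 \o h')) by do 2?apply: GamM.
  rewrite (same_fl g (h \o (g0 \o h'))) //=; first last.
  - move=> x x_n; rewrite gE // -{2}[x]h'K (flips_conj Gg0 fg0 Gh hK) ?Gam_nodes //.
    rewrite g0E ?Gam_nodes //=.
    by rewrite -hb (can2_eq h'K hK).
  - by move=> x x_n; rewrite /= fg0 ?h'K ?Gam_nodes.
  have [h's|h's] := sgn h' Gh'.
    have hs : h s = s by rewrite -{1}h's h'K.
    by rewrite h's g0s rmorphM rmorph_sign hs.
  have hs : h s = - s by rewrite -{1}[s]opprK -h's rmorphN h'K.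
  by rewrite h's rmorphN g0s rmorphN rmorphM rmorph_sign hs mulrN opprK.
pose s' := s * (if chi then sqrt_prod n else 1).
have fs'1 (g : {rmorphism L -> L}) : Gam g -> fixes g n.+1 -> g s' = s'.
  move=> Gg fg; rewrite /s' rmorphM fs //; case: chi {g0s gs s'}; last by rewrite rmorph1.
  congr (_ * _); rewrite rmorph_prod; apply: eq_big_seq => b b_n.
  by rewrite fg // mem_nodesS qmap_sq.
have gs' (g : {rmorphism L -> L}) b : Gam g -> fixes g n -> b \in nodes n ->
    {in nodes n, flips g =1 pred1 b} -> g s' = s'.
  move=> Gg fg b_n gE; rewrite /s' rmorphM (gs g b) //.
  case: (chi); last by rewrite rmorph1 mul1r.
  rewrite (Gam_sqrt_prod Gg fg) (eq_big_seq _ gE).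
  suff -> : \big[addb/false]_(x <- nodes n) pred1 b x = true by rewrite !mulN1r mulrNN.
  rewrite (bigD1_seq b) ?nodes_uniq //= eqxx big1 // => x /negPf; exact.
have fs' (g : {rmorphism L -> L}) : Gam g -> fixes g n -> g s' = s'.
  (* Induction on a list containing the flipped nodes: composing with the flip at its head removes
     one of them. *)
  have {fs'1 gs'} : forall r : seq L, forall g : {rmorphism L -> L}, Gam g -> fixes g n ->
      {in nodes n, forall b, flips g b -> b \in r} -> g s' = s'.
    elim=> [|b r IHr] {}g Gg fg gr.
      apply: fs'1 => // v; rewrite mem_nodesS => v_n.
      have gE : g (sq (qmap v - t)) = sq (qmap v - t).
        by rewrite (flipsE Gg fg v_n); case: (flips g _) (gr _ v_n); rewrite ?mul1r // => /(_ isT).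
      have [vE|vE] := sq_qmapP v; rewrite vE in gE => //.
      by apply: oppr_inj; rewrite -rmorphN.
    have [/andP[b_n gb]|nb] := boolP ((b \in nodes n) && flips g b); last first.
      apply: IHr => // x x_n gx; have := gr x x_n gx; rewrite inE => /orP[/eqP xb|//].
      by rewrite -xb x_n gx in nb.
    have [h [Gh fh hE]] := one_flip b b_n.
    have : h (g s') = h s'.
      rewrite (gs' h b) //; apply: (IHr (h \o g)); first exact: GamM.
        by move=> x x_n; rewrite /= fg ?fh.
      move=> x x_n; rewrite (flips_comp Gh fh Gg fg) // hE //=.
      have [->|xb] := eqVneq x b; first by rewrite gb.
      by move/(gr x x_n); rewrite inE (negPf xb).
    exact: fmorph_inj.
  by move=> /(_ (nodes n)) H Gg fg; apply: H.
have [S SE] : exists S : pred nat, forall g, Gam g ->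
    g (s' * \prod_(i < n | S i) sqrt_prod i) = s' * \prod_(i < n | S i) sqrt_prod i.
  apply: IHn => // g Gg; rewrite exprMn rmorphM s2 //; congr (_ * _).
  case: (chi); last by rewrite expr1n rmorph1.
  by rewrite Gam_sqrt_prod_sqr.
(* At index [n] the predicate records whether [sqrt_prod n] was used to pass from [s] to [s']. *)
exists (fun i => if i == n then chi else S i) => g /SE.
suff -> : s * \prod_(i < n.+1 | if i == n :> nat then chi else S i) sqrt_prod i
    = s' * \prod_(i < n | S i) sqrt_prod i by [].
rewrite /s' -mulrA; congr (_ * _).
rewrite [RHS]mulrC big_mkcond big_ord_recr /= eqxx; congr (_ * _).
by rewrite [RHS]big_mkcond /=; apply: eq_bigr => i _; rewrite ltn_eqF.
Qed.

Hypothesis sqrt_prod_indep : forall n (S : pred nat), ~ (forall g, Gam g ->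
  g (sqrt_prod n * \prod_(i < n | S i) sqrt_prod i)
    = sqrt_prod n * \prod_(i < n | S i) sqrt_prod i).

(** If some flips were missing at level [n], [even_flips_all] would make every element of its
    stabiliser flip an even number of nodes, and so fix [sqrt_prod n]; [fixed_descend] would then
    contradict [sqrt_prod_indep]. *)
Lemma all_flips_all n : all_flips n.
Proof.
elim/ltn_ind: n => n Fn; apply: all_flips_dual => S WS b b_n; apply/negP => Sb.
have Wt : even_flips n (fun=> true) by apply: even_flips_all WS _ => //; exists b.
have [|g Gg fg|T TE] := @fixed_descend n (sqrt_prod n) Fn.
- by move=> g; apply: Gam_sqrt_prod_sqr.
  by rewrite Gam_sqrt_prod // (Wt g) // mul1r.
exact: sqrt_prod_indep TE.
Qed.

(** A realisation up to level [n] agrees with [s] on level [n + 1] up to sibling exchanges, which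
    are corrected by composing with an element fixing level [n]. *)
Lemma realize_tree_map (s : nat -> L -> L) n :
    (forall m x, x \in nodes m -> s m x \in nodes m) ->
    (forall m x, x \in nodes m.+1 -> qmap (s m.+1 x) = s m (qmap x)) ->
    (forall m x y, x \in nodes m -> y \in nodes m -> s m x = s m y -> x = y) ->
  exists2 g : {rmorphism L -> L}, Gam g &
    forall m x, (m <= n)%N -> x \in nodes m -> g x = s m x.
Proof.
move=> s_rs s_ph s_inj; elim: n => [|n [g Gg gE]].
  exists idfun => // m x; rewrite leqn0 => /eqP-> x0.
  by have := s_rs _ _ x0; move: x0; rewrite !inE => /eqP-> /eqP->.
pose e b := s n.+1 (sq (b - t)) != g (sq (b - t)).
have [h [Gh fh hE]] := all_flips_all n e.
have ghE m x : (m <= n)%N -> x \in nodes m -> g (h x) = s m x.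
  by move=> m_n x_m; rewrite (fixes_le Gh m_n fh) // (gE m).
exists (g \o h) => [|m x]; first exact: GamM.
rewrite leq_eqVlt ltnS => /orP[/eqP-> x_n /=|m_n x_m]; last exact: ghE.
have sq_n b : b \in nodes n -> sq (b - t) \in nodes n.+1 by rewrite mem_nodesS qmap_sq.
have b_n : qmap x \in nodes n by rewrite -mem_nodesS.
have s_pm v : v \in nodes n.+1 -> s n.+1 v = g v \/ s n.+1 v = - g v.
  move=> v_n; apply: qmap_inj; rewrite s_ph // -Gam_qmap // (gE n) //.
  by rewrite -mem_nodesS.
have gh_sq : g (h (sq (qmap x - t))) = s n.+1 (sq (qmap x - t)).
  rewrite (hE _ b_n) rmorphM rmorph_sign /e.
  have [->|->] := s_pm _ (sq_n _ b_n); first by rewrite eqxx mul1r.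
  case: eqVneq => [->|_]; last by rewrite mulN1r.
  by rewrite mul1r.
have [xE|xE] := sq_qmapP x; rewrite xE in gh_sq => //.
have x_n' : - x \in nodes n.+1 by rewrite mem_nodesS qmapN -mem_nodesS.
(* Here [x] is the sibling of the chosen root. Injectivity of [s] excludes equal images for the two
   siblings, so their images are opposite. *)
apply: oppr_inj; rewrite -!rmorphN gh_sq.
have : qmap (s n.+1 x) = qmap (s n.+1 (- x)) by rewrite !s_ph // qmapN.
case/qmap_inj=> // E.
have := s_inj _ _ _ x_n' x_n E => /esym/eqP.
by rewrite (negPf (neq_opp (nodes_neq0 x_n))).
Qed.

End TreeGroup.

(** * Extension of embeddings *)

(** Turns a subfield of [L] given as a predicate into a [fieldType], over which polynomials can be
    formed. *)
Record subfieldSet (L : fieldType) := SubfieldSet {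
  sf_pred :> {pred L};
  sf_closed : divring_closed sf_pred
}.

HB.instance Definition _ (L : fieldType) (E : subfieldSet L) :=
  GRing.isDivringClosed.Build L (sf_pred E) (sf_closed E).

Record sfType (L : fieldType) (E : subfieldSet L) := SfType {
  sf_val :> L;
  sf_valP : sf_val \in sf_pred E
}.

HB.instance Definition _ (L : fieldType) (E : subfieldSet L) :=
  [isSub for @sf_val L E].
HB.instance Definition _ (L : fieldType) (E : subfieldSet L) :=
  [Choice of sfType E by <:].
HB.instance Definition _ (L : fieldType) (E : subfieldSet L) :=
  [SubChoice_isSubIntegralDomain of sfType E by <:].
HB.instance Definition _ (L : fieldType) (E : subfieldSet L) :=
  [SubIntegralDomain_isSubField of sfType E by <:].

(** * Minimal polynomials *)

Section MinimalAnnihilator.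

Variables (F L : fieldType) (i : {rmorphism F -> L}) (x : L).

Definition is_minpoly (m : {poly F}) :=
  m != 0 /\ forall p : {poly F}, root (map_poly i p) x = (m %| p).

(** An annihilator that fails to divide another one is replaced by the remainder of the division,
    which is smaller. *)
Lemma minpoly_exists (q : {poly F}) : q != 0 -> root (map_poly i q) x ->
  exists m, is_minpoly m.
Proof.
have [n] := ubnP (size q); elim: n q => // n IHn q /ltnSE-le_q q0 qx.
have [[p px]|nop] := pselect (exists2 p, root (map_poly i p) x & ~~ (q %| p)).
  move=> ndv; apply: (IHn (p %% q)); rewrite ?(leq_trans _ le_q) ?ltn_modpN0 //.
  move: px; rewrite {1}(divp_eq p q) /root !(rmorphD, rmorphM) /= !hornerE.
  by rewrite (rootP qx) mulr0 add0r.
exists q; split=> // p; apply/idP/idP => [px|/dvdpP[r ->]].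
  by apply: contra_notT nop => ndv; exists p.
by rewrite rmorphM /root hornerM (rootP qx) mulr0.
Qed.

(** Write [m = w * d] with [d] a common divisor of [m] and [p]. One factor vanishes at [x]: if it is
    [d], then [m] divides [p]; if it is [w], then [m] divides [w] and [d] is constant. *)
Lemma minpoly_inverse m p : is_minpoly m -> ~~ (m %| p) ->
  exists u v, u * p + v * m = 1.
Proof.
case=> m0 mP ndv; have mx : root (map_poly i m) x by rewrite mP.
suff /Bezout_eq1_coprimepP[[u v] uvE] : coprimep p m by exists u, v.
apply/coprimepP => d dp /dvdpP[w mE]; move: mx.
rewrite mE rmorphM rootM !mP => /orP[mw|/dvdp_trans/(_ dp)mp]; last first.
  by rewrite mp in ndv.
have := m0; rewrite mE mulf_eq0 => /norP[w0 d0].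
have := dvdp_leq w0 mw; rewrite mE size_mul // -size_poly_eq1.
move: w0 d0; rewrite -!size_poly_gt0.
by move: (size w) (size d) => a b; clear; lia.
Qed.

End MinimalAnnihilator.

(** * Graphs of partial embeddings *)

Section Graphs.

Local Open Scope classical_set_scope.

Variables (K L : fieldType) (iota : {rmorphism K -> L}) (M : L -> Prop).
Hypothesis L_sep : is_separable_closure iota.
Hypothesis M_iota : forall a, M (iota a).

(* Graphs, as subsets of [L * L], of the field embeddings into [L], fixing [M]
   pointwise, of the subfields of [L] that contain [M]. *)
Record embedding_graph (R : set (L * L)) : Prop := EmbeddingGraph {
  graph_base : forall x, M x -> R (x, x);
  graph_sub : forall x y x' y', R (x, y) -> R (x', y') -> R (x - x', y - y');
  graph_mul : forall x y x' y', R (x, y) -> R (x', y') -> R (x * x', y * y');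
  graph_inv : forall x y, R (x, y) -> R (x^-1, y^-1);
  graph_fun0 : forall y, R (0, y) -> y = 0
}.

Lemma graph_fun R x y y' : embedding_graph R -> R (x, y) -> R (x, y') -> y = y'.
Proof.
move=> gR xy xy'; apply/eqP; rewrite -subr_eq0; apply/eqP/(graph_fun0 gR).
by have := graph_sub gR xy xy'; rewrite subrr.
Qed.

(** The minimal polynomial of [x] over the domain of [R], transported by the embedding, is separable
    and so has a root [y] in [L]; the extension sends [p(x)] to the value at [y] of the transported
    [p]. *)
Lemma graph_adjoin R x : embedding_graph R ->
  exists R', [/\ embedding_graph R', R `<=` R' & exists y, R' (x, y)].
Proof.
move=> gR; pose E0 : {pred L} := [pred z | `[< exists y, R (z, y) >]].
have R1 : R (1, 1) by rewrite -(rmorph1 iota); apply: graph_base gR _ _.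
have E_closed : divring_closed E0.
  split=> [|a b|a b]; first by apply/asboolP; exists 1.
    move=> /asboolP[u au] /asboolP[v bv]; apply/asboolP.
    by exists (u - v); apply: graph_sub.
  move=> /asboolP[u au] /asboolP[v bv]; apply/asboolP.
  by exists (u / v); apply: graph_mul => //; apply: graph_inv.
pose E := SubfieldSet E_closed; pose F : fieldType := sfType E.
pose i : {rmorphism F -> L} := \val.
have j_ex (z : F) : {y | R (i z, y)} by apply/cid/asboolP/(sf_valP z).
pose j0 z := sval (j_ex z); have j0P z : R (i z, j0 z) := svalP (j_ex z).
have j0B : zmod_morphism j0.
  move=> a b; apply: (graph_fun gR (j0P _)); rewrite rmorphB.
  by have := graph_sub gR (j0P a) (j0P b).
have j0M : monoid_morphism j0.
  split=> [|a b]; first by apply: (graph_fun gR (j0P _)); rewrite rmorph1.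
  apply: (graph_fun gR (j0P _)); rewrite rmorphM.
  by have := graph_mul gR (j0P a) (j0P b).
pose j : {rmorphism F -> L} := HB.pack j0
  (GRing.isZmodMorphism.Build _ _ j0 j0B) (GRing.isMonoidMorphism.Build _ _ j0 j0M).
have jP z : R (i z, j z) := j0P z.
have kP a : iota a \in sf_pred E.
  by apply/asboolP; exists (iota a); apply: graph_base.
pose k0 a : F := SfType (kP a).
have k0B : zmod_morphism k0 by move=> a b; apply: val_inj; rewrite /= !rmorphB.
have k0M : monoid_morphism k0.
  by split=> [|a b]; apply: val_inj; rewrite /= ?rmorph1 ?rmorphM.
pose k : {rmorphism K -> F} := HB.pack k0
  (GRing.isZmodMorphism.Build _ _ k0 k0B) (GRing.isMonoidMorphism.Build _ _ k0 k0M).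
have [q q_sep qx] := L_sep.1 x.
have [m mP] : exists m, is_minpoly i x m.
  apply: (minpoly_exists (q := map_poly k q)).
    by rewrite map_poly_eq0 separable_poly_neq0.
  by rewrite -map_poly_comp.
have [m0 mE] := mP.
have mx : root (map_poly i m) x by rewrite mE.
have m_sep : separable_poly m.
  apply: dvdp_separable (_ : separable_poly (map_poly k q)); last by rewrite separable_map.
  by rewrite -mE -map_poly_comp.
have [||y my] := L_sep.2 (map_poly j m).
- by rewrite separable_map.
- by rewrite size_map_poly -(size_map_poly i) (root_size_gt1 _ mx) // map_poly_eq0.
have jy p : root (map_poly i p) x -> (map_poly j p).[y] = 0.
  by rewrite mE => /dvdpP[w ->]; rewrite rmorphM hornerM (rootP my) mulr0.
pose R' (a : L * L) := exists p, a = ((map_poly i p).[x], (map_poly j p).[y]).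
exists R'; split; last by exists y, 'X; rewrite !map_polyX !hornerX.
  split.
  - move=> z Mz; have zE : z \in sf_pred E by apply/asboolP; exists z; apply: graph_base.
    exists (SfType zE)%:P; rewrite !map_polyC !hornerC; congr (_, _).
    by apply: (graph_fun gR _ (jP _)); apply: graph_base.
  - by move=> a b a' b' [p [-> ->]] [p' [-> ->]]; exists (p - p'); rewrite !rmorphB !hornerE.
  - by move=> a b a' b' [p [-> ->]] [p' [-> ->]]; exists (p * p'); rewrite !rmorphM !hornerE.
  - move=> a b [p [-> ->]]; have [px|npx] := boolP (root (map_poly i p) x).
      (* Both values are 0 here, and the inverse of 0 is 0 by convention. *)
      by exists 0; rewrite (rootP px) (jy _ px) !map_poly0 !horner0 invr0.
    have [|u [v uv]] := minpoly_inverse mP (p := p); first by rewrite -mE.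
    have inv_u (f : {rmorphism F -> L}) z : root (map_poly f m) z ->
        (map_poly f p).[z]^-1 = (map_poly f u).[z].
      move=> mz; apply: mulr1_eq; rewrite mulrC -hornerM -rmorphM.
      have := congr1 (fun r => (map_poly f r).[z]) uv.
      by rewrite rmorphD !rmorphM rmorph1 !hornerE (rootP mz) mulr0 addr0.
    by exists u; rewrite (inv_u i x mx) (inv_u j y my).
  - by move=> b [p [/esym/eqP px ->]]; apply: jy.
move=> [a b] ab; have aE : a \in sf_pred E by apply/asboolP; exists b.
exists (SfType aE)%:P; rewrite !map_polyC !hornerC; congr (_, _).
exact: (graph_fun gR ab (jP (SfType aE))).
Qed.

Lemma graph_extend R : embedding_graph R -> exists g : {rmorphism L -> L},
  [/\ bijective g, forall x, M x -> g x = x & forall x y, R (x, y) -> g x = y].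
Proof.
move=> gR; pose P (Q : set (L * L)) := Q = set0 \/ embedding_graph Q /\ R `<=` Q.
have [F FP Ftot|T [TP Tmax]] := @Zorn_bigcup _ P.
  have [[Q0 [FQ0 Q0n]]|allE] := pselect (exists Q, F Q /\ Q <> set0); last first.
    left; rewrite -subset0 => a [Q FQ Qa]; case: allE; exists Q; split=> // Q0.
    by rewrite Q0 in Qa.
  have FG Q a : F Q -> Q a -> embedding_graph Q /\ R `<=` Q.
    by move=> FQ Qa; case: (FP Q FQ) => // QE; rewrite QE in Qa.
  have [a0 Qa0] : exists a, Q0 a.
    by apply: contra_notP Q0n => nex; rewrite -subset0 => a Qa; case: nex; exists a.
  have [gQ0 RQ0] := FG _ _ FQ0 Qa0.
  have F2 a b : (\bigcup_(Q in F) Q) a -> (\bigcup_(Q in F) Q) b ->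
      exists Q, [/\ F Q, embedding_graph Q, Q a & Q b].
    move=> [Q FQ Qa] [Q' FQ' Qb]; have [gQ _] := FG _ _ FQ Qa; have [gQ' _] := FG _ _ FQ' Qb.
    have [QQ'|Q'Q] := Ftot _ _ FQ FQ'; first by exists Q'; split=> //; apply: QQ'.
    by exists Q; split=> //; apply: Q'Q.
  right; split; last by move=> a Ra; exists Q0 => //; apply: RQ0.
  split.
  - by move=> x Mx; exists Q0 => //; apply: graph_base.
  - move=> x y x' y' xy xy'; have [Q [FQ gQ Qa Qb]] := F2 _ _ xy xy'.
    by exists Q => //; apply: graph_sub.
  - move=> x y x' y' xy xy'; have [Q [FQ gQ Qa Qb]] := F2 _ _ xy xy'.
    by exists Q => //; apply: graph_mul.
  - by move=> x y [Q FQ Qa]; exists Q => //; apply: graph_inv => //; apply: (FG _ _ FQ Qa).1.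
  - by move=> y [Q FQ Qa]; apply: (graph_fun0 (FG _ _ FQ Qa).1).
have R1 : R (1, 1) by rewrite -(rmorph1 iota); apply: graph_base gR _ _.
have [gT RT] : embedding_graph T /\ R `<=` T.
  case: TP => // T0; exfalso; apply: (Tmax R); last by right; split.
  by rewrite T0; split=> [a []|/(_ _ R1) []].
have T_total x : {y | T (x, y)}.
  apply: cid; have [T' [gT' TT' [y xy]]] := graph_adjoin x gT; exists y.
  apply: contrapT => nxy; apply: (Tmax T'); first by split=> // /(_ _ xy).
  by right; split=> //; apply: subset_trans TT'.
pose g0 x := sval (T_total x); have g0P x : T (x, g0 x) := svalP (T_total x).
have g0B : zmod_morphism g0.
  by move=> a b; apply: (graph_fun gT (g0P _)); have := graph_sub gT (g0P a) (g0P b).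
have g0M : monoid_morphism g0.
  split=> [|a b]; first by apply: (graph_fun gT (g0P _)); apply: RT.
  by apply: (graph_fun gT (g0P _)); have := graph_mul gT (g0P a) (g0P b).
pose g : {rmorphism L -> L} := HB.pack g0
  (GRing.isZmodMorphism.Build _ _ g0 g0B) (GRing.isMonoidMorphism.Build _ _ g0 g0M).
have gP x y : T (x, y) -> g x = y by move=> xy; apply: (graph_fun gT (g0P x)).
exists g; split=> [|x Mx|x y /RT/gP //]; last by apply: gP; apply: graph_base.
have g_inj : injective g by apply: fmorph_inj.
(* If [y] had no preimage, its iterates under the injective [g] would be pairwise distinct, giving
   infinitely many roots of a polynomial over [K]. *)
have g_surj y : {x | g x = y}.
  apply: cid; apply: contrapT => nex.
  have [q q_sep qy] := L_sep.1 y; pose q' := map_poly iota q.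
  have q'0 : q' != 0 by rewrite map_poly_eq0 separable_poly_neq0.
  have gq' : map_poly g q' = q'.
    rewrite -map_poly_comp; apply: eq_map_poly => a /=.
    by apply: gP; apply: graph_base.
  have roots n : all (root q') (traject g y n).
    apply/allP => _ /trajectP[k _ ->]; elim: k => //= k IHk.
    by rewrite -gq' fmorph_root.
  have traj_uniq n : uniq (traject g y n).
    have iter_inj k : injective (iter k g) by elim: k => //= k IHk a b /g_inj/IHk.
    elim: n => // n IHn; rewrite trajectSr rcons_uniq IHn andbT.
    apply/trajectP => -[k k_lt]; rewrite -(subnKC (ltnW k_lt)) iterD => /iter_inj.
    have : (0 < n - k)%N by rewrite subn_gt0.
    by case: (n - k)%N => //= d _ /esym yE; apply: nex; exists (iter d g y).
  have := max_poly_roots q'0 (roots (size q')) (traj_uniq _).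
  by rewrite size_traject ltnn.
exists (fun y => sval (g_surj y)) => x; last exact: (svalP (g_surj x)).
by apply: g_inj; apply: (svalP (g_surj _)).
Qed.

Hypothesis M_sub : forall x y, M x -> M y -> M (x - y).
Hypothesis M_mul : forall x y, M x -> M y -> M (x * y).
Hypothesis M_inv : forall x, M x -> M x^-1.

(** The conjugation of the quadratic extension [M(s)] over [M] is an embedding graph, which
    [graph_extend] prolongs to [L]. *)
Lemma conjugate_sqrt s : M (s ^+ 2) -> ~ M s -> exists g : {rmorphism L -> L},
  [/\ bijective g, forall x, M x -> g x = x & g s = - s].
Proof.
move=> Ms2 nMs; have M0 : M 0 by rewrite -(rmorph0 iota).
have M1 : M 1 by rewrite -(rmorph1 iota).
have M_add x y : M x -> M y -> M (x + y).
  by move=> Mx My; rewrite -[y]opprK -[- y]sub0r; do 2?apply: M_sub => //.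
pose R (a : L * L) := exists u v, [/\ M u, M v & a = (u + v * s, u - v * s)].
have gR : embedding_graph R.
  split.
  - by move=> x Mx; exists x, 0; rewrite mul0r addr0 subr0.
  - move=> x y x' y' [u [v [Mu Mv [-> ->]]]] [u' [v' [Mu' Mv' [-> ->]]]].
    by exists (u - u'), (v - v'); split; [exact: M_sub.. | congr (_, _); ring].
  - move=> x y x' y' [u [v [Mu Mv [-> ->]]]] [u' [v' [Mu' Mv' [-> ->]]]].
    exists (u * u' + v * v' * s ^+ 2), (u * v' + v * u').
    split; last by congr (_, _); ring.
      exact: M_add (M_mul Mu Mu') (M_mul (M_mul Mv Mv') Ms2).
    exact: M_add (M_mul Mu Mv') (M_mul Mv Mu').
  - move=> x y [u [v [Mu Mv [-> ->]]]]; pose d := u ^+ 2 - v ^+ 2 * s ^+ 2.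
    have Md : M d by apply: M_sub (M_mul Mu Mu) (M_mul (M_mul Mv Mv) Ms2).
    (* The inverse is the conjugate divided by the norm [d]. *)
    exists (u / d), (- v / d); split.
    + by apply: M_mul => //; apply: M_inv.
    + by apply: M_mul; [rewrite -sub0r; apply: M_sub | apply: M_inv].
    have dE : d = (u + v * s) * (u - v * s) by rewrite /d; ring.
    have [v0|v0] := eqVneq v 0.
      rewrite dE v0 !mul0r subr0 addr0 oppr0 !mul0r subr0 addr0.
      have [->|u0] := eqVneq u 0; first by rewrite mul0r invr0.
      by congr (_, _); field.
    (* Applied with [w = 1] and [w = -1]: a vanishing value would put [s] in [M]. *)
    have uv w : M w -> w * v != 0 -> u + w * v * s != 0.
      move=> Mw wv0; apply: contra_notN nMs => /eqP uE.
      have -> : s = - u / (w * v).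
        apply: (canRL (mulfK wv0)); rewrite mulrC; apply/eqP.
        by rewrite -addr_eq0 addrC uE.
      by apply: M_mul; [rewrite -sub0r; apply: M_sub | apply: M_inv; apply: M_mul].
    have n1 : u + v * s != 0 by rewrite -[v]mul1r uv ?mul1r.
    have n2 : u - v * s != 0.
      rewrite -mulNr -mulN1r uv ?mulN1r ?oppr_eq0 //.
      by rewrite -sub0r; apply: M_sub.
    by rewrite dE; congr (_, _); field; rewrite ?n1 ?n2.
  - move=> y [u [v [Mu Mv [/esym uE ->]]]].
    have [v0|v0] := eqVneq v 0.
      by move: uE; rewrite v0 !mul0r addr0 subr0.
    case: nMs; have -> : s = - u / v.
      by apply: (canRL (mulfK v0)); rewrite mulrC; apply/eqP; rewrite -addr_eq0 addrC uE.
    by apply: M_mul; [rewrite -sub0r; apply: M_sub | apply: M_inv].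
have [g [g_bij gM gE]] := graph_extend gR; exists g; split=> //.
by apply: gE; exists 0, 1; rewrite mul1r add0r sub0r.
Qed.

End Graphs.

(** * The arboreal representation of x^2 + t *)

Lemma fraction_ratio (R : idomainType) (a : {fraction R}) :
  exists n d : R, d != 0 /\ a * tofrac d = tofrac n.
Proof.
elim/quotW: a => r; exists (frac r).1, (frac r).2; split; first exact: denom_ratioP.
unlock FracField.tofrac; rewrite -[LHS]FracField.pi_mul; apply/eqmodP.
rewrite /= FracField.equivfE /FracField.mulf !numden_Ratio ?mulf_neq0 ?oner_neq0 ?denom_ratioP //.
by rewrite !mulr1 mulrC.
Qed.

Lemma rmorph_inverse (L : fieldType) (g : {rmorphism L -> L}) : bijective g ->
  exists g' : {rmorphism L -> L}, cancel g g' /\ cancel g' g.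
Proof.
case=> g' gK g'K.
exists (HB.pack_for {rmorphism L -> L} g'
  (GRing.isZmodMorphism.Build _ _ g' (can2_zmod_morphism gK g'K))
  (GRing.isMonoidMorphism.Build _ _ g' (can2_monoid_morphism gK g'K))).
by split.
Qed.

(** * The geometric Galois group over [k(t)] *)

Section QuadraticFamily.

Variables (k L : fieldType) (iota : {rmorphism {fraction {poly k}} -> L}).
Hypothesis two_neq0 : 2%:R != 0 :> k.
Hypothesis L_sep : is_separable_closure iota.

Local Notation tau := (poly_incl iota 'X).
Local Notation algC := (algebraicOver (const_incl iota)).
Local Notation phi := ('X^2 + 'X%:P : {poly {poly k}}).

Definition alg_poly (q : {poly L}) := forall i, algC q`_i.

(* Algebraic instead of separable constants: the ratios then visibly form a
   field, and fixing this larger field still implies being geometric. *)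
Definition alg_ratio (x : L) := exists q r : {poly L},
  [/\ alg_poly q, alg_poly r, r.[tau] != 0 & x = q.[tau] / r.[tau]].

Lemma alg_poly_sub q r : alg_poly q -> alg_poly r -> alg_poly (q - r).
Proof. by move=> aq ar i; rewrite coefB; apply: algebraic_sub. Qed.

Lemma alg_poly_mul q r : alg_poly q -> alg_poly r -> alg_poly (q * r).
Proof.
move=> aq ar i; rewrite coefM.
by apply: (big_ind algC) => [|x y|j _]; [exact: algebraic0 | exact: algebraic_add |
  exact: algebraic_mul].
Qed.

Lemma alg_polyC a : algC a -> alg_poly a%:P.
Proof. by move=> aa i; rewrite coefC; case: ifP => // _; apply: algebraic0. Qed.

Lemma alg_poly_map p : alg_poly (map_poly (const_incl iota) p).
Proof. by move=> i; rewrite coef_map; apply: algebraic_id. Qed.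

Lemma poly_incl_horner p : poly_incl iota p = (map_poly (const_incl iota) p).[tau].
Proof.
elim/poly_ind: p => [|p a IHp]; first by rewrite !rmorph0 horner0.
have -> : map_poly (const_incl iota) (p * 'X + a%:P)
    = map_poly (const_incl iota) p * 'X + (const_incl iota a)%:P.
  by rewrite rmorphD rmorphM /= map_polyX map_polyC.
by rewrite hornerD hornerM hornerX hornerC -IHp rmorphD rmorphM.
Qed.

(** A nonzero [q] would make [tau] integral over [k] by transitivity, although [k[t]] embeds in
    [L]. *)
Lemma tau_transcendental q : alg_poly q -> q.[tau] = 0 -> q = 0.
Proof.
move=> aq q0; apply/eqP; apply: contraT => q_neq0.
have [p p_mon] : integralOver (const_incl iota) tau.
  apply: (integral_root q_neq0); first exact/rootP.
  by move=> _ /(nthP 0)[i _ <-]; apply/integral_algebraic/aq.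
rewrite /root -poly_incl_horner fmorph_eq0 tofrac_eq0.
by rewrite (negPf (monic_neq0 p_mon)).
Qed.

Lemma alg_ratio_horner q : alg_poly q -> alg_ratio q.[tau].
Proof.
move=> aq; exists q, 1; rewrite hornerC oner_neq0 divr1; split=> //.
exact/alg_polyC/algebraic1.
Qed.

Lemma alg_ratio_sub x y : alg_ratio x -> alg_ratio y -> alg_ratio (x - y).
Proof.
move=> [q [r [aq ar r0 ->]]] [q' [r' [aq' ar' r0' ->]]].
exists (q * r' - q' * r), (r * r'); split.
- by apply: alg_poly_sub; apply: alg_poly_mul.
- exact: alg_poly_mul.
- by rewrite hornerM mulf_neq0.
by rewrite !hornerE -mulNr addf_div // mulNr.
Qed.

Lemma alg_ratio_mul x y : alg_ratio x -> alg_ratio y -> alg_ratio (x * y).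
Proof.
move=> [q [r [aq ar r0 ->]]] [q' [r' [aq' ar' r0' ->]]].
exists (q * q'), (r * r'); split; try exact: alg_poly_mul.
  by rewrite hornerM mulf_neq0.
by rewrite !hornerM mulf_div.
Qed.

Lemma alg_ratio_inv x : alg_ratio x -> alg_ratio x^-1.
Proof.
move=> [q [r [aq ar r0 ->]]]; have [q0|q0] := eqVneq q.[tau] 0.
  rewrite q0 mul0r invr0 -(horner0 tau); apply: alg_ratio_horner => i.
  by rewrite coef0; apply: algebraic0.
by exists r, q; rewrite invf_div.
Qed.

Lemma alg_ratio_iota a : alg_ratio (iota a).
Proof.
have [n [d [d0 /(congr1 iota)]]] := fraction_ratio a.
rewrite rmorphM => E.
have d0' : poly_incl iota d != 0 by rewrite fmorph_eq0 tofrac_eq0.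
exists (map_poly (const_incl iota) n), (map_poly (const_incl iota) d).
split; try exact: alg_poly_map; rewrite -!poly_incl_horner //.
by rewrite /poly_incl /= -E mulfK.
Qed.

Lemma alg_ratio_ksep_t x : in_ksep_t iota x -> alg_ratio x.
Proof.
have alg y : in_ksep iota y -> algC y.
  by case=> q /separable_poly_neq0 q0 qy; exists q.
by move=> [q [r [aq ar r0 ->]]]; exists q, r; split=> // i; apply: alg.
Qed.

Definition geom_aut (g : {rmorphism L -> L}) := bijective g /\ forall x, alg_ratio x -> g x = x.

Lemma geom_aut_id : geom_aut idfun.
Proof. by split=> //; exists idfun. Qed.

Lemma geom_aut_comp g h : geom_aut g -> geom_aut h -> geom_aut (g \o h).
Proof.
move=> [gb gM] [hb hM]; split=> [|x Mx /=]; first exact: bij_comp.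
by rewrite hM ?gM.
Qed.

Lemma geom_aut_inverse g : geom_aut g ->
  exists g' : {rmorphism L -> L}, [/\ geom_aut g', cancel g g' & cancel g' g].
Proof.
move=> [gb gM]; have [g' [gK g'K]] := rmorph_inverse gb.
exists g'; split=> //; split=> [|x Mx]; first by exists g.
by rewrite -{1}(gM x Mx) gK.
Qed.

Lemma geom_aut_tau g : geom_aut g -> g tau = tau.
Proof. by case=> _; apply; apply: alg_ratio_iota. Qed.

Lemma two_neq0_L : 2%:R != 0 :> L.
Proof. by rewrite -(rmorph_nat (const_incl iota)) fmorph_eq0. Qed.

Lemma alg_polyX : alg_poly 'X.
Proof. by move=> i; rewrite coefX; case: (_ == _); [apply: algebraic1 | apply: algebraic0]. Qed.

Lemma alg_crit n : alg_poly (crit L n).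
Proof.
elim: n => [|n IHn]; first exact/alg_polyC/algebraic0.
rewrite critS -['X]opprK; apply: alg_poly_sub; first exact: alg_poly_mul.
by rewrite -sub0r; apply: alg_poly_sub; [exact/alg_polyC/algebraic0 | exact: alg_polyX].
Qed.

Lemma crit_tau_neq0 n : (crit L n.+1).[tau] != 0.
Proof.
apply: contraNneq (crit_neq0 L n) => /tau_transcendental ->//.
exact: alg_crit.
Qed.

Lemma sqrt_exists (x : L) : {y | y ^+ 2 = x}.
Proof.
(* The case [x = 0] is apart because ['X^2] is not separable. *)
have [->|x0] := eqVneq x 0; first by exists 0; rewrite expr0n.
apply: cid; have [||y] := L_sep.2 ('X^2 - x%:P).
- rewrite unlock derivB derivC subr0 derivXn expr1 /=.
  rewrite -mulr_natl -polyC_natr mul_polyC coprimepZr ?two_neq0_L //.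
  rewrite -['X in X in coprimep _ X]subr0 -polyC0 coprimep_XsubC.
  by rewrite /root !hornerE expr0n sub0r oppr_eq0.
- by rewrite size_XnsubC.
by rewrite /root !hornerE subr_eq0 => /eqP yE; exists y.
Qed.

Definition sqrtL x := sval (sqrt_exists x).

Lemma sqrtLK x : sqrtL x ^+ 2 = x.
Proof. exact: (svalP (sqrt_exists x)). Qed.

Local Notation nodes := (nodes tau sqrtL).
Local Notation qmap := (qmap tau).
Local Notation sqrt_prod := (sqrt_prod tau sqrtL).

(** The square of such a product [s] is a signed product of critical values. If all geometric
    automorphisms fixed [s], then [s] would be a ratio [q / r] by [conjugate_sqrt], and
    transcendence of [tau] would turn this into a polynomial identity excluded by
    [crit_prod_nonsquare]. *)
Lemma sqrt_prod_indep n (S : pred nat) : ~ (forall g, geom_aut g ->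
  g (sqrt_prod n * \prod_(i < n | S i) sqrt_prod i)
    = sqrt_prod n * \prod_(i < n | S i) sqrt_prod i).
Proof.
set s := _ * _ => fix_s.
pose Q := crit L n.+1 * \prod_(i < n | S i) crit L i.+1.
have [e s2E] : exists e : nat, s ^+ 2 = (-1) ^+ e * Q.[tau].
  have [e eE] : exists e : nat, (\prod_(i < n | S i) sqrt_prod i) ^+ 2
      = (-1) ^+ e * (\prod_(i < n | S i) crit L i.+1).[tau].
    apply: (big_ind2 (fun x q => exists e : nat, x ^+ 2 = (-1) ^+ e * q.[tau])).
    - by exists 0%N; rewrite hornerC mulr1 expr1n.
    - move=> x q y r [e xE] [f yE]; exists (e + f)%N.
      by rewrite exprMn xE yE exprD hornerM mulrACA.
    - by move=> i _; exists (size (nodes i)); apply: sqrt_prod_sqr sqrtLK _.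
  exists (size (nodes n) + e)%N.
  by rewrite exprMn eE (sqrt_prod_sqr tau sqrtLK n) exprD hornerM mulrACA.
have aQ : alg_poly ((-1) ^+ e *: Q).
  rewrite -mul_polyC; apply: alg_poly_mul; first apply: alg_polyC.
    elim: e {s2E} => [|e IHe]; first exact: algebraic1.
    rewrite exprS; apply: algebraic_mul IHe.
    exact/algebraic_opp/algebraic1.
  apply: alg_poly_mul; first exact: alg_crit.
  apply: (big_ind alg_poly) => [|q r|i _]; first exact/alg_polyC/algebraic1.
    exact: alg_poly_mul.
  exact: alg_crit.
have Ms2 : alg_ratio (s ^+ 2) by rewrite s2E -hornerZ; apply: alg_ratio_horner.
have s0 : s != 0.
  have P0 i : sqrt_prod i != 0 by apply: sqrt_prod_neq0 sqrtLK crit_tau_neq0 _.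
  by rewrite mulf_neq0 //; apply/prodf_neq0.
have [q [r [aq ar r0 sE]]] : alg_ratio s.
  apply: contrapT => nMs.
  have [g [gb gM gs]] := 
    conjugate_sqrt L_sep alg_ratio_iota alg_ratio_sub alg_ratio_mul alg_ratio_inv Ms2 nMs.
  have := fix_s g (conj gb gM); rewrite -/s gs => /esym/eqP.
  by rewrite (negPf (neq_opp two_neq0_L s0)).
have : q ^+ 2 = (-1) ^+ e *: Q * r ^+ 2.
  apply/eqP; rewrite -subr_eq0; apply/eqP/tau_transcendental.
    by apply: alg_poly_sub; rewrite ?expr2; do ?apply: alg_poly_mul.
  rewrite hornerD hornerN horner_exp hornerM horner_exp hornerZ -s2E sE.
  by rewrite expr_div_n divfK ?subrr // expf_neq0.
apply: (crit_prod_nonsquare two_neq0_L); first by rewrite signr_eq0.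
by apply: contraNneq r0 => ->; rewrite horner0.
Qed.

Lemma nodes_root n x :
  root (map_poly (poly_incl iota) (iterate phi n)) x = (x \in nodes n).
Proof.
rewrite (mem_nodes tau sqrtLK) /root; congr (_ == 0).
elim: n => [|n IHn]; first by rewrite /iterate /= map_polyX hornerX.
by rewrite phi_iterateS rmorphD rmorphXn /= map_polyC hornerD hornerC horner_exp IHn.
Qed.

Lemma phi_horner x : (map_poly (poly_incl iota) phi).[x] = qmap x.
Proof. by rewrite rmorphD rmorphXn /= map_polyX map_polyC !hornerE. Qed.

Local Notation node := (node iota phi).

Definition mk_node n x (x_n : x \in nodes n) : node :=
  exist _ (n, x) (etrans (nodes_root n x) x_n).

Lemma node_rs (u : node) : node_val u \in nodes (level u).
Proof. by rewrite -nodes_root; apply: (valP u). Qed.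

Lemma node_eq (u v : node) : level u = level v -> node_val u = node_val v -> u = v.
Proof.
move=> luv vuv; apply: val_inj; rewrite [LHS]surjective_pairing [RHS]surjective_pairing.
by congr (_, _).
Qed.

Lemma childP (v u : node) :
  reflect (level v = (level u).+1 /\ qmap (node_val v) = node_val u) (child v u).
Proof. by rewrite /child phi_horner; apply: (iffP andP) => -[/eqP-> /eqP->]. Qed.

Lemma child_inj (v u u' : node) : child v u -> child v u' -> u = u'.
Proof.
move=> /childP[lu vu] /childP[lu' vu']; apply: node_eq; last by rewrite -vu vu'.
by apply: succn_inj; rewrite -lu.
Qed.

Lemma parent_exists (v : node) n : level v = n.+1 -> exists u : node, child v u.
Proof.
move=> lv; have v_n : qmap (node_val v) \in nodes n.
  by rewrite -(mem_nodesS tau sqrtLK) -lv node_rs.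
by exists (mk_node v_n); apply/childP.
Qed.

Lemma level0_root (u : node) : level u = 0%N -> u = tree_root iota phi.
Proof.
move=> lu; apply: node_eq => //; have := node_rs u.
by rewrite lu inE => /eqP.
Qed.

(** * Realising a tree automorphism *)

Section TreeAutomorphism.

Variable sigma : node -> node.
Hypothesis sigma_aut : is_tree_automorphism sigma.

Lemma sigma_inj : injective sigma.
Proof. by have [/bij_inj] := sigma_aut. Qed.

(** Adjacency has no direction, so [sigma u] might be the parent of the image of the parent [w] of
    [u]. By induction that parent is the image of the parent of [w], which contradicts
    injectivity. *)
Lemma sigma_level u : level (sigma u) = level u.
Proof.
have [_ sigma0 sigma_adj] := sigma_aut.
have [n] := ubnP (level u); elim: n u => // n IHn u /ltnSE le_u.
case lu : (level u) => [|m].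
  by rewrite (level0_root lu) sigma0.
have [w uw] := parent_exists lu; have /childP[luw _] := uw.
have lw : level w = m by apply: succn_inj; rewrite -luw.
have lsw : level (sigma w) = m by rewrite IHn lw // -lu.
have : adjacent (sigma u) (sigma w) by rewrite sigma_adj /adjacent uw.
case/orP=> [/childP[-> _]|wu]; first by rewrite lsw.
have /childP[lwu _] := wu; case: m lu lw lsw => [|m] lu lw lsw; first by rewrite lsw in lwu.
have [v wv] := parent_exists lw; have /childP[lwv _] := wv.
have lv : level v = m by apply: succn_inj; rewrite -lwv.
have lsv : level (sigma v) = m by rewrite IHn lv //; apply: leq_trans le_u; rewrite lu.
have : adjacent (sigma w) (sigma v) by rewrite sigma_adj /adjacent wv.
case/orP=> [wv'|/childP[]]; last by rewrite lsv lsw => /eqP; rewrite ltn_eqF //; lia.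
have /sigma_inj uv := child_inj wu wv'.
by move: lu; rewrite uv lv; lia.
Qed.

Lemma sigma_child v u : child v u -> child (sigma v) (sigma u).
Proof.
move=> vu; have [_ _ sigma_adj] := sigma_aut.
have : adjacent (sigma v) (sigma u) by rewrite sigma_adj /adjacent vu.
case/orP=> // /childP[]; rewrite !sigma_level.
by have /childP[-> _] := vu; lia.
Qed.

(* Junk value 0 when [x] is not a node of level [n]. *)
Definition sigma_val n x : L :=
  if insub (n, x) is Some u then node_val (sigma u) else 0.

Lemma sigma_valE u : sigma_val (level u) (node_val u) = node_val (sigma u).
Proof.
rewrite /sigma_val; have -> : (level u, node_val u) = val u by rewrite [RHS]surjective_pairing.
by rewrite valK.
Qed.

Lemma sigma_realized n : exists2 g : {rmorphism L -> L}, geom_aut g &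
  forall m x, (m <= n)%N -> x \in nodes m -> g x = sigma_val m x.
Proof.
have svE m x (x_m : x \in nodes m) : sigma_val m x = node_val (sigma (mk_node x_m)).
  by rewrite -sigma_valE.
apply: (realize_tree_map two_neq0_L sqrtLK geom_aut_id geom_aut_comp
  geom_aut_inverse geom_aut_tau crit_tau_neq0 sqrt_prod_indep).
- by move=> m x x_m; rewrite svE; have := node_rs (sigma (mk_node x_m)); rewrite sigma_level.
- move=> m x x_m; have x_m' : qmap x \in nodes m by rewrite -(mem_nodesS tau sqrtLK).
  have : child (mk_node x_m) (mk_node x_m') by apply/childP.
  by move/sigma_child/childP => [_]; rewrite !svE.
- move=> m x y x_m y_m; rewrite !svE => E.
  have /sigma_inj/(congr1 (@node_val _ _ _ _)) : sigma (mk_node x_m) = sigma (mk_node y_m).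
    by apply: node_eq; rewrite ?sigma_level.
  by [].
Qed.

(** The graph [R] plays the role of a compactness argument: a pair belongs to it once all
    automorphisms agreeing with [sigma] up to some level send its first entry to the second. *)
Lemma sigma_geometric : in_geometric_image sigma.
Proof.
pose agree n (g : {rmorphism L -> L}) :=
  forall m x, (m <= n)%N -> x \in nodes m -> g x = sigma_val m x.
have agree_le m n g : (m <= n)%N -> agree n g -> agree m g.
  by move=> mn gn i x im; apply: gn; apply: leq_trans mn.
pose R (a : L * L) := exists n, forall g, geom_aut g -> agree n g -> g a.1 = a.2.
have gR : embedding_graph alg_ratio R.
  split.
  - by move=> x Mx; exists 0%N => g [_ gM] _; apply: gM.
  - move=> x y x' y' [n xy] [n' xy']; exists (maxn n n') => g Gg ag /=.
    have [an an'] := (agree_le _ _ _ (leq_maxl n n') ag, agree_le _ _ _ (leq_maxr n n') ag).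
    by rewrite rmorphB (xy g) ?(xy' g).
  - move=> x y x' y' [n xy] [n' xy']; exists (maxn n n') => g Gg ag /=.
    have [an an'] := (agree_le _ _ _ (leq_maxl n n') ag, agree_le _ _ _ (leq_maxr n n') ag).
    by rewrite rmorphM (xy g) ?(xy' g).
  - by move=> x y [n xy]; exists n => g Gg ag /=; rewrite fmorphV (xy g).
  (* Only this point needs a realisation up to level [n] to exist; without one the condition
     defining [R] would be vacuous. *)
  - move=> y [n y0]; have [g Gg gE] := sigma_realized n.
    by have := y0 g Gg gE; rewrite /= rmorph0.
have [g [gb gM gE]] := graph_extend L_sep alg_ratio_iota gR.
exists (AbsoluteGalois gb (fun a => gM _ (alg_ratio_iota a))).
  by move=> x /alg_ratio_ksep_t; apply: gM.
move=> u; apply: node_eq; first by rewrite sigma_level.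
rewrite -sigma_valE; apply: gE; exists (level u) => g' _ /=; apply => //.
exact: node_rs.
Qed.

End TreeAutomorphism.

Lemma geometric_tree_automorphism (sigma : node -> node) :
  in_geometric_image sigma -> is_tree_automorphism sigma.
Proof.
case=> g _ gE.
have [g' [gK g'K]] := rmorph_inverse (gal_bij g).
have g'fix a : g' (iota a) = iota a by rewrite -{1}(gal_fix g a) gK.
pose G' : absolute_galois iota := AbsoluteGalois (Bijective g'K gK) g'fix.
have sE u : level (sigma u) = level u /\ node_val (sigma u) = g (node_val u).
  by rewrite -gE.
split.
- exists (@arboreal_rep _ _ _ phi G') => u.
    apply: node_eq; first exact: (sE u).1.
    by rewrite -[LHS]/(g' (node_val (sigma u))) (sE u).2; apply: gK.
  by rewrite -gE; apply: node_eq => //; apply: g'K.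
- by apply: level0_root; rewrite (sE _).1.
have child_s u v : child (sigma u) (sigma v) = child u v.
  rewrite /child !(sE _).1 !(sE _).2 !phi_horner; congr (_ && _).
  rewrite -[RHS](inj_eq (fmorph_inj g)); congr (_ == _).
  by rewrite /qmap rmorphD rmorphXn /poly_incl /= gal_fix.
by move=> u v; rewrite /adjacent !child_s.
Qed.

Lemma quadratic_geometrically_surjective : geometrically_surjective iota phi.
Proof.
move=> sigma; split; first exact: geometric_tree_automorphism.
exact: sigma_geometric.
Qed.

End QuadraticFamily.

Theorem theorem4p1 (p : nat) (p_prime : prime p) (p_odd : odd p)
    (L : fieldType) (iota : {rmorphism {fraction {poly 'F_p}} -> L})
    (L_sep : is_separable_closure iota) :
  geometrically_surjective iota (reduction p phi_Z).
Proof.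
rewrite reduction_phi; apply: quadratic_geometrically_surjective => //.
by have [] := reduction_phi_arboreal p_prime p_odd.
Qed.
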